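(* Let $n\ge 1$ and $1\le k\le n$ be integers, let $\mu\in\mathbb{R}$, and let $\mu_0:=\sqrt{\frac{k}{n(k+1)(C_n^k)^{1/k}}}$. Suppose that $f\in C(\mathbb{R})$ is a positive and monotone non-decreasing function. (i) (Existence) Suppose that either $k=1$ and $\mu\in(-\infty,+\infty)$, or $2\le k\le n$ and $\mu\in[0,+\infty)$. If $f$ satisfies $$\int^{+\infty}\left(\int_{0}^{\tau}f^k(t)\,dt\right)^{-\frac{1}{k+1}}d\tau=+\infty,$$ then the equation $S_k^{1/k}(D^2u+\mu|Du|I)=f(u)$ in $\mathbb{R}^n$ admits a subsolution $u\in\Phi_\mu^k(\mathbb{R}^n)$. (ii) (Nonexistence) Suppose that $1\le k\le n$ and $\mu\in(-\infty,\mu_0)$. If $f$ satisfies $$\int^{+\infty}\left(\int_{0}^{\tau}f^k(t)\,dt\right)^{-\frac{1}{k+1}}d\tau<+\infty,$$ then the equation $S_k^{1/k}(D^2u+\mu|Du|I)=f(u)$ in $\mathbb{R}^n$ admits no subsolution $u\in\Phi_\mu^k(\mathbb{R}^n)$.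
   Context: $C_n^k$ denotes the binomial coefficient $\binom{n}{k}$. For $\lambda=(\lambda_1,\dots,\lambda_n)\in\mathbb{R}^n$, $S_k(\lambda)=\sum_{1\le i_1<\cdots<i_k\le n}\lambda_{i_1}\cdots\lambda_{i_k}$ is the $k$-th elementary symmetric function, and for a real symmetric $n\times n$ matrix $r$ with eigenvalues $\lambda(r)$, $S_k(r):=S_k(\lambda(r))$; $S_k^{1/k}$ is the $k$-th root of $S_k$. $Du$ and $D^2u$ are the gradient and Hessian of $u$, $|Du|$ is the Euclidean norm of the gradient, and $I$ is the $n\times n$ identity matrix. $\Gamma_k=\{\lambda\in\mathbb{R}^n: S_p(\lambda)>0 \text{ for all } p=1,\dots,k\}$. The class of admissible functions is $\Phi_\mu^k(\mathbb{R}^n)=\{u\in C^2(\mathbb{R}^n):\lambda(D^2u(x)+\mu|Du(x)|I)\in\Gamma_k\ \text{for all } x\in\mathbb{R}^n\}$. A subsolution $u\in\Phi_\mu^k(\mathbb{R}^n)$ of the equation $S_k^{1/k}(D^2u+\mu|Du|I)=f(u)$ in $\mathbb{R}^n$ is a function $u\in\Phi_\mu^k(\mathbb{R}^n)$ with $S_k^{1/k}(D^2u+\mu|Du|I)\ge f(u)$ at every point of $\mathbb{R}^n$. In the integrals $\int^{+\infty}$ the omitted lower limit is an arbitrary positive number. *)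

(* Defs.v *)
From mathcomp Require Import all_boot all_order all_algebra.
From mathcomp Require Import all_classical all_reals all_analysis.
Import Order.TTheory GRing.Theory Num.Theory.
Import numFieldNormedType.Exports.
Set Implicit Arguments.
Unset Strict Implicit.
Unset Printing Implicit Defensive.
Local Open Scope classical_set_scope.
Local Open Scope ring_scope.

Definition elem_sym (R : realType) (n k : nat) (l : 'rV[R]_n) : R :=
  \sum_(A : {set 'I_n} | #|A| == k) \prod_(i in A) l 0 i.

(* The eigenvalues of [r], listed with algebraic multiplicity in some order.
   They exist as soon as [r] is symmetric; otherwise, if the characteristic
   polynomial does not split over [R], this is the junk value 0. *)
Definition eigvals (R : realType) (n : nat) (r : 'M[R]_n) : 'rV[R]_n :=
  xget 0 [set l : 'rV[R]_n | char_poly r = \prod_(i < n) ('X - (l 0 i)%:P)].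

Definition Sk (R : realType) (n k : nat) (r : 'M[R]_n) : R :=
  elem_sym k (eigvals r).

Definition GammaK (R : realType) (n k : nat) : set 'rV[R]_n :=
  [set l | forall p : nat, (1 <= p <= k)%N -> 0 < elem_sym p l].

Definition partial_d (R : realType) (n : nat) (i : 'I_n) (u : 'rV[R]_n -> R)
  (x : 'rV[R]_n) : R := 'D_(delta_mx 0 i) u x.

Definition grad (R : realType) (n : nat) (u : 'rV[R]_n -> R) (x : 'rV[R]_n) :
  'rV[R]_n := \row_(i < n) partial_d i u x.

Definition hess (R : realType) (n : nat) (u : 'rV[R]_n -> R) (x : 'rV[R]_n) :
  'M[R]_n := \matrix_(i < n, j < n) partial_d i (partial_d j u) x.

(* The library norm on ['rV[R]_n] is the sup norm, hence this definition. *)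
Definition enorm (R : realType) (n : nat) (v : 'rV[R]_n) : R :=
  Num.sqrt (\sum_(i < n) v 0 i ^+ 2).

Definition C2 (R : realType) (n : nat) (u : 'rV[R]_n -> R) : Prop :=
  [/\ continuous u,
      forall i x, derivable u x (delta_mx 0 i),
      forall i, continuous (partial_d i u),
      forall i j x, derivable (partial_d i u) x (delta_mx 0 j) &
      forall i j, continuous (partial_d j (partial_d i u))].

Definition hess_mu (R : realType) (n : nat) (mu : R) (u : 'rV[R]_n -> R)
  (x : 'rV[R]_n) : 'M[R]_n := hess u x + (mu * enorm (grad u x))%:M.

Definition Phi (R : realType) (n k : nat) (mu : R) : set ('rV[R]_n -> R) :=
  [set u | C2 u /\ forall x, GammaK k (eigvals (hess_mu mu u x))].

Definition is_subsolution (R : realType) (n k : nat) (mu : R) (f : R -> R)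
  (u : 'rV[R]_n -> R) : Prop :=
  Phi k mu u /\ forall x, f (u x) <= Sk k (hess_mu mu u x) `^ k%:R^-1.

Definition mu0 (R : realType) (n k : nat) : R :=
  Num.sqrt (k%:R / (n%:R * k.+1%:R * 'C(n, k)%:R `^ k%:R^-1)).

Definition KO_integral (R : realType) (k : nat) (f : R -> R) (a : R) : \bar R :=
  (\int[lebesgue_measure]_(tau in `[a, +oo[)
     ((\int[lebesgue_measure]_(t in `[0, tau]) (f t ^+ k))%R
        `^ (- k.+1%:R^-1))%:E)%E.

(* Main.v *)
(** Both parts rest on radial functions v(x) = psi(s0 + A|x|^2/2) with psi' = G(psi),
    where G is comparable to (int_b^. f^k)^{1/(k+1)}: then D^2 v = alpha I + beta x x^T,
    psi exists on a half-line iff int 1/G diverges, and G^k G' = f^k/(k+1).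
    If the Keller-Osserman integral diverges, v is an entire subsolution for A large.
    If it converges, psi blows up at a finite point and, for A small, v is a strict
    supersolution on a ball, infinite on its boundary, with v(0) < u(0).  At an interior
    maximum of u - v the matrix of u is at most alpha I + beta x x^T, so all its
    eigenvalues but one are at most alpha; since S_k is increasing on Gamma_k, this bounds
    S_k from above by its value at the supersolution, a contradiction.  Monotonicity of S_k
    on Gamma_k follows from Newton's inequality, itself a consequence of the fact that
    derivatives of real-rooted polynomials are real-rooted. *)

Require Import Defs.
From mathcomp Require Import all_boot all_order all_algebra.
From mathcomp Require Import all_classical all_reals all_analysis.
From mathcomp Require Import complex measurable_realfun ring lra zify.
Import Order.TTheory GRing.Theory Num.Theory.
Import numFieldNormedType.Exports.
Set Implicit Arguments.
Unset Strict Implicit.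
Unset Printing Implicit Defensive.
Local Open Scope classical_set_scope.
Local Open Scope ring_scope.

(** * Real-rooted polynomials and elementary symmetric functions *)

(** Up to constants, [Sk] of alpha I + beta x x^T is alpha^(k-1) (alpha + beta |x|^2), with alpha of
    order A G and beta = A^2 G' G. The beta part contains G^k G', which the choice of G turns into
    f^k, but it carries a factor |x|^2; the alpha part is of order A^k G^k, and the ODE says nothing
    about it. This is the obstacle on both sides. For existence the beta part is useless near the
    origin, and there a large A makes the alpha part exceed f^k, which is bounded on that region.
    For nonexistence G^k must be at most a multiple of f^k; this is drawn from the convergence of
    the integral itself ([Wfun_le_f]). The exploding supersolution is used only up to a finite level
    above the maximum of u, so no infinite values occur. Eigenvalues are listed in an unspecified
    order, so matrices enter only through factorizations of their characteristic polynomials. The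
    comparison at the touching point is between quadratic forms, and an argument on pairs of
    eigenvectors turns it into a comparison of spectra. *)

Definition real_rooted (R : rcfType) (p : {poly R}) : Prop :=
  forall z : R[i], root (map_poly (real_complex R) p) z -> complex.Im z = 0.

Lemma real_rooted_split (R : rcfType) (p : {poly R}) : real_rooted p ->
  exists rs, p = lead_coef p *: \prod_(r <- rs) ('X - r%:P).
Proof.
move=> rp; have [->|p0] := eqVneq p 0.
  by exists [::]; rewrite lead_coef0 scale0r.
have [zs zsE] := closed_field_poly_normal (map_poly (real_complex R) p).
exists (map (@complex.Re R) zs); apply: (map_poly_inj (real_complex R)).
rewrite map_polyZ/= rmorph_prod/= big_map [LHS]zsE lead_coef_map.
congr (_ *: _); apply: eq_big_seq => z zin.
rewrite rmorphB/= map_polyX map_polyC/=; congr ('X - _%:P).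
have rz : complex.Im z = 0.
  apply: rp; rewrite zsE rootZ ?root_prod_XsubC//.
  by rewrite lead_coef_eq0 map_poly_eq0.
by rewrite [LHS]complexE rz mulr0 addr0.
Qed.

Lemma Im_inv_sub (R : rcfType) (z : R[i]) (r : R) : complex.Im z != 0 ->
  z - r%:C%C != 0 /\ complex.Im z * complex.Im (z - r%:C%C)^-1 < 0.
Proof.
case: z => x y /= y0; split; first by rewrite eq_complex/= subr0 negb_and y0 orbT.
rewrite subr0 mulrN oppr_lt0 mulrA -expr2 mulr_gt0 ?exprn_even_gt0//.
by rewrite invr_gt0 ltr_wpDl ?sqr_ge0// exprn_even_gt0.
Qed.

(* Gauss-Lucas for real roots: off the real axis [q'/q = \sum 1/(z - r)] has an
   imaginary part of the sign opposite to that of [complex.Im z]. *)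
Lemma log_deriv_Im (R : rcfType) (rs : seq R) (z : R[i]) : complex.Im z != 0 ->
  let q := \prod_(r <- rs) ('X - (r%:C%C)%:P) in
  q.[z] != 0 /\ (rs != [::] -> complex.Im z * complex.Im (q^`().[z] / q.[z]) < 0).
Proof.
move=> z0; elim: rs => [|r rs [q0 IH]] /=; first by rewrite big_nil hornerC oner_neq0.
have [zr0 zrI] := Im_inv_sub r z0.
rewrite big_cons; set q := \prod_(_ <- rs) _ in q0 IH *.
split; first by rewrite hornerM hornerXsubC mulf_neq0.
move=> _; rewrite derivM derivXsubC mul1r hornerD !hornerM hornerXsubC.
have -> : (q.[z] + (z - r%:C%C) * q^`().[z]) / ((z - r%:C%C) * q.[z]) =
  (z - r%:C%C)^-1 + q^`().[z] / q.[z] by field; rewrite q0.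
rewrite raddfD/= mulrDr; case: (eqVneq rs [::]) => [rs0|/IH]; last first.
  by move=> ?; rewrite ltr_wnDr// ltW.
by rewrite /q rs0 big_nil derivC horner0 mul0r mulr0 addr0.
Qed.

(** The zero polynomial is not real-rooted in this sense, since every complex number is a root of
    it; hence the condition on the derivative. At a non-real zero of p' the logarithmic derivative
    would vanish, against the strict sign in [log_deriv_Im]. *)
Lemma real_rooted_deriv (R : rcfType) (p : {poly R}) :
  real_rooted p -> p^`() != 0 -> real_rooted p^`().
Proof.
move=> rp p'0 z; have [rs pE] := real_rooted_split rp.
have p0 : p != 0 by apply: contraNneq p'0 => ->; rewrite derivC.
rewrite /root -deriv_map pE map_polyZ/= rmorph_prod/=.
under eq_bigr do rewrite rmorphB/= map_polyX map_polyC/=.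
rewrite derivZ hornerZ mulf_eq0 fmorph_eq0 lead_coef_eq0 (negbTE p0)/= => q'0.
apply/eqP; apply: contraNT p'0 => z0.
have [_] := log_deriv_Im rs z0; case: (eqVneq rs [::]) => [rs0 _|rs0 /(_ isT)].
  by rewrite pE rs0 big_nil derivZ derivC scaler0.
by rewrite (eqP q'0) mul0r mulr0 ltxx.
Qed.

Lemma real_rooted_derivn (R : rcfType) (p : {poly R}) n :
  real_rooted p -> p^`(n) != 0 -> real_rooted p^`(n).
Proof.
move=> rp; elim: n => [//|n IH]; rewrite derivnS => h.
by apply: real_rooted_deriv => //; apply: IH; apply: contraNneq h => ->; rewrite derivC.
Qed.

(* Laguerre's inequality [q'^2 - q q'' >= 0] at the origin *)
Lemma real_rooted_laguerre (R : rcfType) (p : {poly R}) : real_rooted p ->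
  (p`_0 * p`_2) *+ 2 <= p`_1 ^+ 2.
Proof.
move=> /real_rooted_split[rs ->]; set c := lead_coef p; clearbody c.
rewrite !coefZ; suff : let q := \prod_(r <- rs) ('X - r%:P) in
    (q`_0 * q`_2) *+ 2 <= q`_1 ^+ 2.
  by move=> /= h; have := sqr_ge0 c; nra.
elim: rs => [|r rs /=]; first by rewrite big_nil /= !coef1 !mulr0 mul0rn sqr_ge0.
rewrite big_cons /=; set q := \prod_(_ <- rs) _ => IH.
rewrite mulrBl !coefB !coefXM !coefCM/=.
have := sqr_ge0 r; have := sqr_ge0 q`_0; nra.
Qed.

(** Laguerre's inequality for the m-th derivative, whose three lowest coefficients are integer
    multiples of those of index m, m+1, m+2 in p. *)
Lemma real_rooted_newton (R : rcfType) (p : {poly R}) m : real_rooted p ->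
  0 <= p`_m * p`_m.+2 -> p`_m * p`_m.+2 <= p`_m.+1 ^+ 2.
Proof.
move=> rp pp; have [d0|d0] := eqVneq p^`(m) 0.
  have c0 i : p`_(m + i) = 0.
    have := congr1 (fun q : {poly R} => q`_i) d0.
    rewrite coef_derivn coef0 => /eqP; rewrite mulrn_eq0 => /orP[|/eqP//].
    by rewrite -leqn0 leqNgt ffact_gt0 leq_addr.
  by have := c0 0%N; rewrite addn0 => ->; rewrite mul0r sqr_ge0.
have := real_rooted_laguerre (real_rooted_derivn rp d0).
rewrite !coef_derivn addn0 addn1 addn2.
rewrite -!(mulr_natl p`__) -(mulr_natl (_ * _)).
set A := (m ^_ m)%N; set B := (m.+1 ^_ m)%N; set D := (m.+2 ^_ m)%N.
have A1 : (B ^ 2 <= 2 * A * D)%N.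
  have -> : A = m`! by rewrite /A ffactnn.
  have BE : B = m.+1`! by rewrite -(ffact_fact (leqnSn m)) subSnn muln1.
  have DE : (2 * D = m.+2`!)%N.
    have -> : (2 = (m.+2 - m)`!)%N by have -> : (m.+2 - m = 2)%N by lia.
    by rewrite mulnC /D ffact_fact; lia.
  rewrite mulnAC DE BE !factS; nia.
have B0 : (0 < B)%N by rewrite /B ffact_gt0 leqnSn.
have {A1}A1 : B%:R ^+ 2 <= 2 * A%:R * D%:R :> R by rewrite -natrX -!natrM ler_nat.
have {B0} : 0 < B%:R ^+ 2 :> R by rewrite exprn_gt0// ltr0n.
move=> B0 L; rewrite -(ler_pM2l B0).
apply: (@le_trans _ _ (2 * A%:R * D%:R * (p`_m * p`_m.+2))); first exact: ler_wpM2r.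
by apply: le_trans (le_trans _ L) _; rewrite le_eqVlt; apply/orP; left; apply/eqP; ring.
Qed.

(** The generating polynomial of the elementary symmetric functions of s. Its roots are the numbers
    -1/a, a zero entry only lowering the degree, so Newton's inequality applies directly to its
    coefficients. *)
Definition esym_gen (R : comNzRingType) (s : seq R) : {poly R} :=
  \prod_(a <- s) (1 + a *: 'X).

Lemma esym_gen_cons (R : comNzRingType) (a : R) s :
  esym_gen (a :: s) = (1 + a *: 'X) * esym_gen s.
Proof. by rewrite /esym_gen big_cons. Qed.

Lemma coef_esym_gen0 (R : comNzRingType) (s : seq R) : (esym_gen s)`_0 = 1.
Proof.
elim: s => [|a s IH]; first by rewrite /esym_gen big_nil coef1.
by rewrite esym_gen_cons coef0M IH coefD coef1 coefZ coefX mulr0 addr0 mul1r.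
Qed.

Lemma coef_esym_gen_cons (R : comNzRingType) (a : R) s p :
  (esym_gen (a :: s))`_p.+1 = (esym_gen s)`_p.+1 + a * (esym_gen s)`_p.
Proof. by rewrite esym_gen_cons mulrDl mul1r coefD -scalerAl coefZ coefXM. Qed.

Lemma esym_gen_real_rooted (R : rcfType) (s : seq R) : real_rooted (esym_gen s).
Proof.
move=> z; elim: s => [|a s IH]; first by rewrite /esym_gen big_nil rmorph1 (negbTE (root1 _)).
rewrite esym_gen_cons rmorphM rootM => /orP[|//].
rewrite rmorphD rmorph1/= map_polyZ/= map_polyX /root hornerD hornerC hornerZ hornerX.
case: z {IH} => x y; rewrite eq_complex/= => /andP[h1 h2].
move: h1 h2; rewrite !mul0r subr0 addr0 add0r mulf_eq0 => h1 /orP[/eqP a0|/eqP//].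
by move: h1; rewrite a0 mul0r addr0 oner_eq0.
Qed.

(* If [(1 + a X) Q] has positive coefficients up to order [k], then so has [Q]
   up to order [k - 1]: the failure of the first one contradicts Newton. *)
Lemma esym_gen_tail_gt0 (R : rcfType) (a : R) s k :
  (forall p, (p <= k)%N -> 0 < (esym_gen (a :: s))`_p) ->
  forall p, (p < k)%N -> 0 < (esym_gen s)`_p.
Proof.
move=> G p; elim/ltn_ind: p => -[_ _|p IH pk]; first by rewrite coef_esym_gen0.
have Q0 : 0 < (esym_gen s)`_p by apply: IH => //; exact: ltnW.
have := G p.+1 (ltnW pk); have := G p.+2 pk; rewrite !coef_esym_gen_cons.
have := @real_rooted_newton _ _ p (@esym_gen_real_rooted _ s).
set x := (esym_gen s)`_p in Q0 *; set y := (esym_gen s)`_p.+1.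
set w := (esym_gen s)`_p.+2 => N h2 h1; case: ltP => // y0.
have a0 : 0 < a by rewrite -(pmulr_lgt0 _ Q0); lra.
have w0 : 0 < w by nra.
have := N (ltW (mulr_gt0 Q0 w0)); rewrite leNgt => /negP; case.
(* Together [u1] and [u2] give y^2 <= - a x y < x w, the reverse of Newton's inequality. *)
have u1 : 0 <= (a * x + y) * - y by apply: mulr_ge0; lra.
have u2 : 0 < x * (w + a * y) by apply: mulr_gt0; lra.
nra.
Qed.

(** Each coefficient is affine in a single entry, with slope a coefficient of the product over the
    other entries, positive by [esym_gen_tail_gt0]. So the entries can be raised one at a time,
    positivity being preserved along the way. *)
Lemma le_coef_esym_gen (R : rcfType) (s t : seq R) k :
  all2 <=%R s t -> (forall p, (p <= k)%N -> 0 < (esym_gen s)`_p) ->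
  (esym_gen s)`_k <= (esym_gen t)`_k.
Proof.
(* The prefix u collects the entries that have already been replaced. *)
suff : forall u, all2 <=%R s t ->
    (forall p, (p <= k)%N -> 0 < (esym_gen (u ++ s))`_p) ->
    (esym_gen (u ++ s))`_k <= (esym_gen (u ++ t))`_k by move/(_ [::]).
elim: s t => [|a s IH] [|b t] u //= /andP[ab st] G.
have pE c v : esym_gen (u ++ c :: v) = esym_gen (c :: u ++ v).
  by apply: perm_big; rewrite perm_catC/= perm_cons perm_catC.
have le_p p : (p <= k)%N ->
    (esym_gen (a :: u ++ s))`_p <= (esym_gen (b :: u ++ s))`_p.
  case: p => [_|p pk]; first by rewrite !coef_esym_gen0.
  rewrite !coef_esym_gen_cons lerD2l ler_wpM2r//.
  apply: ltW; apply: (@esym_gen_tail_gt0 _ a _ k) => // q qk.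
  by rewrite -pE; exact: G.
rewrite (pE a) (pE b); apply: (le_trans (le_p k (leqnn k))).
rewrite -!cat_cons; apply: IH => // p pk.
by rewrite cat_cons; apply: lt_le_trans (le_p p pk); rewrite -pE; exact: G.
Qed.

Lemma coef_esym_gen_nseq (R : comNzRingType) (a : R) m p :
  (esym_gen (nseq m a))`_p = 'C(m, p)%:R * a ^+ p.
Proof.
elim: m p => [|m IH] [|p]; rewrite ?coef_esym_gen0 ?bin0 ?mulr1//.
  by rewrite /esym_gen big_nil coef1 bin0n mul0r.
by rewrite coef_esym_gen_cons !IH binS natrD exprS; ring.
Qed.

(** The list is the spectrum of alpha I + beta x x^T. Raising one factor al to ga makes the two
    terms proportional, and Pascal's rule adds their coefficients. *)
Lemma coef_esym_gen_nseq_le (R : rcfType) (al ga : R) m p :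
  0 <= al -> al <= ga ->
  (esym_gen (ga :: nseq m al))`_p.+1 <= 'C(m.+1, p.+1)%:R * (al ^+ p * ga).
Proof.
move=> al0 alga; rewrite coef_esym_gen_cons !coef_esym_gen_nseq.
rewrite binS natrD mulrDl lerD//; last by rewrite mulrCA (mulrC ga).
by rewrite exprSr ler_wpM2l// ler_wpM2l// exprn_ge0.
Qed.

Lemma coef_esym_gen_nseq_ge (R : rcfType) (al ga : R) m p :
  0 <= al -> al <= ga -> (p <= m)%N ->
  al ^+ p * ga <= (esym_gen (ga :: nseq m al))`_p.+1.
Proof.
move=> al0 alga pm; have ga0 := le_trans al0 alga.
rewrite coef_esym_gen_cons !coef_esym_gen_nseq.
rewrite ler_wpDl ?mulr_ge0 ?exprn_ge0// mulrC ler_wpM2l//.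
by rewrite ler_peMl ?exprn_ge0// ler1n bin_gt0.
Qed.

(** * Eigenvalues of rank-one perturbations *)

Lemma dot_ge0 (R : realDomainType) n (x : 'rV[R]_n) : 0 <= (x *m x^T) 0 0.
Proof. by rewrite mxE sumr_ge0// => i _; rewrite mxE -expr2 sqr_ge0. Qed.

Section SpectralBound.
Local Open Scope sesquilinear_scope.



(** The matrix determinant lemma, obtained by two block eliminations in the bordered matrix [U]. It
    is multiplied by t to avoid division, as it is applied over a polynomial ring with t = X -
    alpha. *)
Lemma det_scalar_sub_rank1 (R : idomainType) n (t : R) (v : 'rV[R]_n) (w : 'cV[R]_n) :
  t != 0 -> \det (t%:M - w *m v) * t = t ^+ n * (t - (v *m w) 0 0).
Proof.
move=> t0.
pose U : 'M[R]_(1 + n) := block_mx 1%:M v w (t%:M).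
have -> : \det (t%:M - w *m v) = \det U.
  have : block_mx 1%:M 0 (- w) 1%:M *m U = block_mx 1%:M v 0 (t%:M - w *m v).
    rewrite mulmx_block !mul1mx !mul0mx !mulmx1 !addr0 mulNmx.
    by rewrite addNr addrC.
  move/(congr1 (@determinant _ _)); rewrite det_mulmx det_lblock det_ublock.
  by rewrite !det1 !mul1r => ->.
have : U *m block_mx (t%:M) 0 (- w) 1%:M = block_mx (t%:M - v *m w) v 0 t%:M.
  rewrite mulmx_block !mul1mx !mulmx0 !mulmx1 !add0r mulmxN.
  by congr block_mx; rewrite mulmxN mul_scalar_mx mul_mx_scalar subrr.
move/(congr1 (@determinant _ _)).
rewrite det_mulmx det_lblock det_ublock !det_scalar expr1n mulr1 expr1 => ->.
by rewrite det_mx11 !mxE eqxx mulr1n mulrC.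
Qed.

Lemma char_poly_scalar_rank1 (R : idomainType) n (al be : R) (x : 'rV[R]_n.+1) :
  char_poly (al%:M + be *: (x^T *m x)) =
  \prod_(a <- (al + be * (x *m x^T) 0 0) :: nseq n al) ('X - a%:P).
Proof.
have t0 : 'X - al%:P != 0 by rewrite polyXsubC_eq0.
rewrite big_cons (_ : \prod_(_ <- nseq _ _) _ = ('X - al%:P) ^+ n); last first.
  by rewrite big_nseq; elim: n {x} => //= n ->; rewrite exprS.
apply: (mulIf t0); rewrite /char_poly /char_poly_mx.
have -> : 'X%:M - map_mx polyC (al%:M + be *: (x^T *m x)) =
   ('X - al%:P)%:M - map_mx polyC (be *: x^T) *m map_mx polyC x.
  rewrite map_mxD map_scalar_mx/= raddfB/= opprD addrA -map_mxM/=.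
  by rewrite -scalemxAl.
rewrite det_scalar_sub_rank1// -map_mxM -scalemxAr 2!mxE polyCD opprD addrA.
by rewrite exprSr mulrC mulrA.
Qed.

Lemma char_poly_similar (F : fieldType) n (P A B : 'M[F]_n) :
  P \in unitmx -> A = invmx P *m B *m P -> char_poly A = char_poly B.
Proof.
move=> Pu ->; rewrite /char_poly /char_poly_mx.
set Q := map_mx polyC P; set Q' := map_mx polyC (invmx P).
have QQ : Q' *m Q = 1%:M by rewrite -map_mxM mulVmx// map_scalar_mx.
have -> : 'X%:M - map_mx polyC (invmx P *m B *m P) =
    Q' *m ('X%:M - map_mx polyC B) *m Q.
  rewrite mulmxBr mulmxBl !map_mxM/=; congr (_ - _).
  by rewrite mul_mx_scalar -scalemxAl QQ scalemx1.
rewrite !det_mulmx mulrAC -det_mulmx QQ det1 mul1r//.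
Qed.


(** The diagonalizing matrix is unitary with complex rows, whereas the bound on the form is known
    for real vectors; this identity transfers it. The cross terms cancel because M is symmetric. *)
Lemma quad_form_complex (R : rcfType) n (M : 'M[R]_n) (w : 'rV[R[i]]_n) :
  M^T = M ->
  let a := map_mx (@complex.Re R) w in let b := map_mx (@complex.Im R) w in
  (w *m map_mx (real_complex R) M *m w ^t*) 0 0 =
  real_complex R ((a *m M *m a^T) 0 0 + (b *m M *m b^T) 0 0).
Proof.
move=> Msym a b; pose toC := map_mx (real_complex R).
have wE : w = toC _ _ a + 'i%C *: toC _ _ b.
  by apply/matrixP => i j; rewrite !mxE [LHS]complexE.
have wtE : w ^t* = toC _ _ a^T - 'i%C *: toC _ _ b^T.
  apply/matrixP => p q; rewrite !mxE; case: (w q p) => u v.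
  apply/eqP; rewrite eq_complex/=.
  by rewrite mulr0 !mul0r !mul1r !subr0 !add0r !eqxx.
have ba : b *m M *m a^T = a *m M *m b^T.
  have tr1 (Z : 'M[R]_1) : Z^T = Z by apply/matrixP => p q; rewrite !ord1 mxE.
  by rewrite -[LHS]tr1 !trmx_mul trmxK Msym mulmxA.
rewrite {1}wE wtE mulmxDl mulmxDl !mulmxBr -!scalemxAl -!scalemxAr -!map_mxM/= ba.
rewrite addrA subrK scalerA -expr2 sqr_i scaleN1r opprK mxE [X in _ + X]mxE !mxE.
by rewrite rmorphD.
Qed.

Lemma entryE (R : pzRingType) m n (i : 'I_m) (j : 'I_n) :
  ((forall A B : 'M[R]_(m, n), ((A + B) i j = A i j + B i j)%R) *
   (forall A : 'M[R]_(m, n), ((- A) i j = - A i j)%R) *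
   (forall c (A : 'M[R]_(m, n)), ((c *: A) i j = c * A i j)%R))%type.
Proof. by do !split => *; rewrite mxE. Qed.

Lemma cauchy_schwarz_rV (R : rcfType) n (y z : 'rV[R]_n) :
  (y *m z^T) 0 0 ^+ 2 <= (y *m y^T) 0 0 * (z *m z^T) 0 0.
Proof.
have dotC : (z *m y^T) 0 0 = (y *m z^T) 0 0.
  by rewrite !mxE; apply: eq_bigr => i _; rewrite !mxE mulrC.
have [z0|z0] := eqVneq ((z *m z^T) 0 0) 0.
  have -> : z = 0.
    apply/matrixP => i j; rewrite mxE ord1; move/eqP: z0.
    rewrite mxE psumr_eq0 => [|k _]; last by rewrite mxE -expr2 sqr_ge0.
    by move/allP/(_ j (mem_index_enum _)); rewrite mxE mulf_eq0 orbb => /eqP.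
  by rewrite trmx0 !mulmx0 !mxE expr0n/= mulr0.
have zp : 0 < (z *m z^T) 0 0 by rewrite lt_def z0 dot_ge0.
(* This vector is the component of y orthogonal to z, scaled by |z|^2 to avoid a division. *)
have := dot_ge0 ((z *m z^T) 0 0 *: y - (y *m z^T) 0 0 *: z).
move: dotC zp; set a := (z *m z^T) 0 0; set b := (y *m z^T) 0 0.
have -> u v : (u *: y - v *: z)^T = u *: y^T - v *: z^T.
  by apply/matrixP => p q; rewrite !mxE.
move=> dotC zp; rewrite !mulmxBl !mulmxBr -!scalemxAl -!scalemxAr.
rewrite !entryE -/a -/b dotC; set c := (y *m y^T) 0 0 => h.
by rewrite -subr_ge0 -(pmulr_rge0 _ zp); lra.
Qed.

Lemma hermitian_form_comb (C : numClosedFieldType) n (M : 'M[C]_n)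
    (c1 c2 d1 d2 : C) (v1 v2 : 'rV[C]_n) (w := c1 *: v1 + c2 *: v2) :
  v1 *m M = d1 *: v1 -> v2 *m M = d2 *: v2 ->
  (v1 *m v1^t* ) 0 0 = 1 -> (v2 *m v2^t* ) 0 0 = 1 ->
  (v1 *m v2^t* ) 0 0 = 0 -> (v2 *m v1^t* ) 0 0 = 0 ->
  (w *m M *m w^t* ) 0 0 = `|c1| ^+ 2 * d1 + `|c2| ^+ 2 * d2 /\
  (w *m w^t* ) 0 0 = `|c1| ^+ 2 + `|c2| ^+ 2.
Proof.
move=> e1 e2 n1 n2 o1 o2; rewrite !normCK.
have wt : w^t* = c1^* *: v1^t* + c2^* *: v2^t*.
  by apply/matrixP => p q; rewrite !mxE rmorphD !rmorphM.
have wM : w *m M = (c1 * d1) *: v1 + (c2 * d2) *: v2.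
  by rewrite mulmxDl -!scalemxAl e1 e2 !scalerA.
rewrite wM wt; split.
  rewrite mulmxDl !mulmxDr -!scalemxAl -!scalemxAr !entryE n1 n2 o1 o2; ring.
rewrite mulmxDl !mulmxDr -!scalemxAl -!scalemxAr !entryE n1 n2 o1 o2; ring.
Qed.

Section QuadraticFormBound.
Variables (R : rcfType) (n : nat) (A : 'M[R]_n.+1) (al be : R) (x : 'rV[R]_n.+1).
Hypothesis A_sym : A^T = A.
Hypothesis be_ge0 : 0 <= be.
Hypothesis A_le : forall y : 'rV[R]_n.+1,
  (y *m A *m y^T) 0 0 <= al * (y *m y^T) 0 0 + be * (y *m x^T) 0 0 ^+ 2.

Local Notation toC := (real_complex R).
Local Notation AC := (map_mx toC A).
Local Notation xC := (map_mx toC x^T).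
Local Notation P := (spectralmx AC).

Let AC_herm : AC \is hermsymmx.
Proof.
apply: realsym_hermsym.
  apply/is_hermitianmxP; rewrite scale1r map_mx_id//.
  by rewrite map_trmx A_sym.
apply/mxOverP => i j; rewrite mxE; apply/Creal_ImP.
by rewrite -complexIm.
Qed.

Let d i := complex.Re (spectral_diag AC 0 i).

Let diagE i : spectral_diag AC 0 i = toC (d i).
Proof.
have /mxOverP/(_ 0 i) := hermitian_spectral_diag_real AC_herm.
by rewrite /d => /Creal_ImP h; rewrite complexRe [LHS]Crect h mulr0 addr0.
Qed.

Let spectralE : AC = invmx P *m diag_mx (spectral_diag AC) *m P.
Proof. by apply/orthomx_spectralP; apply: hermitian_normalmx. Qed.

Let char_polyE : char_poly A = \prod_i ('X - (d i)%:P).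
Proof.
apply: (map_poly_inj toC); rewrite map_char_poly.
rewrite (char_poly_similar (spectral_unit AC) spectralE).
rewrite char_poly_trig ?diag_mx_is_trig// rmorph_prod/=.
apply: eq_bigr => i _; rewrite rmorphB/= map_polyX map_polyC/=.
by rewrite mxE eqxx mulr1n diagE.
Qed.

Let row_orth i j : (row i P *m (row j P)^t*) 0 0 = (i == j)%:R.
Proof.
have /row_unitarymxP/(_ i j) := spectral_unitarymx AC.
by rewrite dotmxE.
Qed.

Let row_eigen i : row i P *m AC = toC (d i) *: row i P.
Proof.
have := spectralE => /(congr1 (mulmx P)); rewrite !mulmxA mulmxV ?spectral_unit//.
rewrite mul1mx => /(congr1 (row i)); rewrite !row_mul row_diag_mx -diagE => ->.
by rewrite -scalemxAl -rowE.
Qed.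

Let real_form_le (w : 'rV[R[i]]_n.+1) :
  let a := map_mx (@complex.Re R) w in let b := map_mx (@complex.Im R) w in
  (w *m AC *m w ^t*) 0 0 <= toC (al * ((a *m a^T) 0 0 + (b *m b^T) 0 0) +
     be * ((a *m x^T) 0 0 ^+ 2 + (b *m x^T) 0 0 ^+ 2)).
Proof.
rewrite /=; set a := map_mx _ w; set b := map_mx _ w.
rewrite quad_form_complex//= lecR -/a -/b; have := A_le a; have := A_le b; lra.
Qed.

Let norm_form (w : 'rV[R[i]]_n.+1) :
  let a := map_mx (@complex.Re R) w in let b := map_mx (@complex.Im R) w in
  (w *m w ^t*) 0 0 = toC ((a *m a^T) 0 0 + (b *m b^T) 0 0).
Proof.
have := @quad_form_complex _ _ 1%:M w; rewrite trmx1 => /(_ erefl).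
rewrite /= map_mx1 !mulmx1 => h; exact: h.
Qed.

(** The form is tested on a unit eigenvector; Cauchy-Schwarz is applied to its real and imaginary
    parts, whose squared norms add up to 1. *)
Lemma eigenvalue_le i : d i <= al + be * (x *m x^T) 0 0.
Proof.
have /= := norm_form (row i P); have /= := real_form_le (row i P).
rewrite row_eigen -scalemxAl entryE row_orth eqxx mulr1.
set a := map_mx _ _; set b := map_mx _ _; rewrite lecR => L N.
have {}N : (a *m a^T) 0 0 + (b *m b^T) 0 0 = 1 by apply: complexI; rewrite -N.
apply: le_trans L _; rewrite N mulr1 lerD2l ler_wpM2l//.
have := cauchy_schwarz_rV a x; have := cauchy_schwarz_rV b x; nra.
Qed.

Let form_le_orth (w : 'rV[R[i]]_n.+1) : (w *m xC) 0 0 = 0 ->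
  (w *m AC *m w ^t*) 0 0 <= toC al * (w *m w ^t*) 0 0.
Proof.
move=> wx; apply: le_trans (real_form_le w) _.
rewrite norm_form -rmorphM/= lecR.
have -> : (map_mx (@complex.Re R) w *m x^T) 0 0 = 0.
  have := congr1 (@complex.Re R) wx; rewrite !mxE raddf_sum/= => h.
  rewrite -[RHS]h; apply: eq_bigr => k _; rewrite !mxE.
  by case: (w 0 k) => ? ? /=; rewrite mulr0 subr0.
have -> : (map_mx (@complex.Im R) w *m x^T) 0 0 = 0.
  have := congr1 (@complex.Im R) wx; rewrite !mxE raddf_sum/= => h.
  rewrite -[RHS]h; apply: eq_bigr => k _; rewrite !mxE.
  by case: (w 0 k) => ? ? /=; rewrite mulr0 add0r.
by rewrite expr0n/= addr0 mulr0 addr0.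
Qed.

(* Two eigenvectors have a nonzero combination orthogonal to [x]. *)
Lemma eigenvalue_pair_le i j : i != j -> (d i <= al) || (d j <= al).
Proof.
move=> ij; rewrite -implyNb -ltNge; apply/implyP => di; rewrite leNgt; apply/negP => dj.
pose c1 := (row j P *m xC) 0 0; pose c2 := (row i P *m xC) 0 0.
(* If c2 vanishes, row i is itself orthogonal to x. Otherwise c1 row i - c2 row j is orthogonal to x
   and nonzero, and on it the form would exceed al times the squared norm. *)
have [c20|c20] := eqVneq c2 0.
  have := form_le_orth c20; rewrite row_eigen -scalemxAl mxE row_orth eqxx !mulr1 lecR.
  by rewrite leNgt di.
have [] := @hermitian_form_comb _ _ AC c1 (- c2) (toC (d i)) (toC (d j))
  (row i P) (row j P) (row_eigen i) (row_eigen j).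
- by rewrite row_orth eqxx.
- by rewrite row_orth eqxx.
- by rewrite row_orth (negbTE ij).
- by rewrite row_orth eq_sym (negbTE ij).
have : ((c1 *: row i P + (- c2) *: row j P) *m xC) 0 0 = 0.
  by rewrite mulmxDl -!scalemxAl !entryE -/c1 -/c2 mulrC mulNr subrr.
move/form_le_orth; set w := (X in X *m AC) => h1 h2 h3.
move: h1; rewrite h2 h3 normrN mulrDr ![toC al * _]mulrC lt_geF//.
have c2p : 0 < `|c2| ^+ 2 by rewrite exprn_gt0// normr_gt0.
have c1p : 0 <= `|c1| ^+ 2 by rewrite exprn_ge0.
by apply: ler_ltD; rewrite ?(ler_wpM2l c1p) ?(ltr_pM2l c2p) ?lecR ?ltcR// ltW.
Qed.

(** By [eigenvalue_pair_le] at most one eigenvalue exceeds al. Listing that one first makes the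
    comparison with the model spectrum entrywise, with no sorting. *)
Lemma spectrum_rank1_bound : exists s : seq R,
  char_poly A = \prod_(a <- s) ('X - a%:P) /\
  all2 <=%R s ((al + be * (x *m x^T) 0 0) :: nseq n al).
Proof.
have [i di] : exists i, forall j, j != i -> d j <= al.
  have [/existsP[i di]|/existsPn nd] := boolP [exists i, al < d i].
    exists i => j ji; have := eigenvalue_pair_le ji.
    by rewrite [X in _ || X]leNgt di orbF.
  by exists ord0 => j _; rewrite leNgt nd.
exists (d i :: map d (enum [pred j | j != i])); split.
  rewrite char_polyE (bigD1 i)//= big_cons big_map.
  by rewrite -big_enum.
rewrite /= eigenvalue_le/=.
have sz : size (enum [pred j | j != i]) = n.
  by rewrite -cardE cardC1 card_ord.
have : {subset enum [pred j | j != i] <= [pred j | j != i]} by move=> j; rewrite mem_enum.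
have -> : nseq n al = nseq (size (enum [pred j | j != i])) al by rewrite sz.
elim: (enum _) => //= j s IH js.
rewrite di ?IH//; last by have := js j (mem_head _ _); rewrite inE.
by move=> k ks; apply: js; rewrite inE ks orbT.
Qed.
End QuadraticFormBound.

End SpectralBound.

Lemma elem_sym_coef (R : realType) n p (l : 'rV[R]_n) :
  elem_sym p l = (esym_gen [seq l 0 i | i <- enum 'I_n])`_p.
Proof.
rewrite /esym_gen big_map big_enum/=.
rewrite (eq_bigr (fun i => l 0 i *: 'X + 1)); last by move=> i _; rewrite addrC.
rewrite bigA_distr coef_sum /elem_sym big_mkcond/=; apply: eq_bigr => J _.
have -> : \prod_i (if i \in J then l 0 i *: 'X else 1) =
    (\prod_(i in J) l 0 i) *: 'X^#|J| :> {poly R}.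
  rewrite -big_mkcond/=; under eq_bigr do rewrite -mul_polyC.
  by rewrite big_split/= prodr_const -rmorph_prod/= mul_polyC.
by rewrite coefZ coefXn eq_sym; case: eqP => _; rewrite ?mulr1 ?mulr0.
Qed.

(** The given factorization shows that [eigvals] is not at its default value, and unique
    factorization makes its entries a permutation of s; symmetric functions do not see the order. *)
Lemma elem_sym_eigvals (R : realType) n (r : 'M[R]_n) (s : seq R) p :
  char_poly r = \prod_(a <- s) ('X - a%:P) ->
  elem_sym p (eigvals r) = (esym_gen s)`_p.
Proof.
move=> rs; have sz : size s = n.
  by apply: succn_inj; rewrite -(size_prod_XsubC s id) -rs size_char_poly.
rewrite elem_sym_coef.
suff h : perm_eq [seq eigvals r 0 i | i <- enum 'I_n] s.
  by rewrite /esym_gen (perm_big _ h).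
apply: prod_XsubC_eq; rewrite -rs big_map big_enum/=; apply/esym.
apply: (@xgetPex _ 0 [set l : 'rV[R]_n | char_poly r = \prod_(i < n) ('X - (l 0 i)%:P)]).
exists (\row_i s`_i); rewrite /= rs (big_nth 0) big_mkord sz.
by apply: eq_bigr => i _; rewrite mxE.
Qed.

Lemma Sk_rank1_le (R : realType) n k (A : 'M[R]_n.+1) (al be : R) (x : 'rV[R]_n.+1) :
  A^T = A -> 0 <= al -> 0 <= be ->
  (forall y : 'rV[R]_n.+1,
    (y *m A *m y^T) 0 0 <= al * (y *m y^T) 0 0 + be * (y *m x^T) 0 0 ^+ 2) ->
  GammaK k.+1 (eigvals A) ->
  Sk k.+1 A <= 'C(n.+1, k.+1)%:R * (al ^+ k * (al + be * (x *m x^T) 0 0)).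
Proof.
move=> Asym al0 be0 Ale G.
have [s [sA st]] := spectrum_rank1_bound Asym be0 Ale.
have xx0 := dot_ge0 x.
rewrite /Sk (elem_sym_eigvals _ sA).
apply: le_trans (le_coef_esym_gen st _) _ => [[|p] pk|].
- by rewrite coef_esym_gen0.
- by rewrite -(elem_sym_eigvals _ sA); apply: G.
- by apply: coef_esym_gen_nseq_le => //; rewrite lerDl mulr_ge0.
Qed.

Lemma elem_sym_rank1_ge (R : realType) n p (al be : R) (x : 'rV[R]_n.+1) :
  0 <= al -> 0 <= be -> (p <= n)%N ->
  al ^+ p * (al + be * (x *m x^T) 0 0) <=
    elem_sym p.+1 (eigvals (al%:M + be *: (x^T *m x))).
Proof.
move=> al0 be0 pn; rewrite (elem_sym_eigvals _ (char_poly_scalar_rank1 _ _ _)).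
by apply: coef_esym_gen_nseq_ge => //; rewrite lerDl mulr_ge0// dot_ge0.
Qed.

Lemma elem_sym_rank1_trace (R : realType) n (al be : R) (x : 'rV[R]_n.+1) :
  elem_sym 1 (eigvals (al%:M + be *: (x^T *m x))) =
  n.+1%:R * al + be * (x *m x^T) 0 0.
Proof.
rewrite (elem_sym_eigvals _ (char_poly_scalar_rank1 _ _ _)).
rewrite coef_esym_gen_cons coef_esym_gen0 coef_esym_gen_nseq bin1 expr1.
by rewrite -natr1; ring.
Qed.

(** * Differential calculus *)

Lemma mvt_cc (R : realType) (f df : R -> R) (a b : R) : a <= b ->
  (forall t, a <= t <= b -> is_derive t 1 f (df t)) ->
  exists2 c, a <= c <= b & f b - f a = df c * (b - a).
Proof.
move=> ab fd; have [||c cab e] := @MVT_segment _ f df a b ab.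
- by move=> t /itvP tab; apply: fd; rewrite !tab.
- by apply: derivable_within_continuous => t /itvP tab; apply: ex_derive; apply: fd; rewrite !tab.
by exists c; rewrite // !(itvP cab).
Qed.

Lemma is_derive_lineP (R : realType) (V : normedModType R) (h : V -> R) (y v : V) (t l : R) :
  is_derive (y + t *: v) v h l <-> is_derive t 1 (fun s => h (y + s *: v)) l.
Proof.
have e : (fun r : R => r^-1 *: ((h \o shift (y + t *: v)) (r *: v) - h (y + t *: v))) =
   (fun r : R => r^-1 *: (((fun s => h (y + s *: v)) \o shift t) (r *: (1 : R)) -
                 (fun s => h (y + s *: v)) t)).
  apply/funext => r /=; congr (_ *: (h _ - _)).
  by rewrite [r *: (1 : R)]mulr1 scalerDl addrCA.
by split=> -[]; rewrite /derivable /derive ?e -?e => h1 h2; split;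
  rewrite /derivable /derive ?e -?e.
Qed.

Lemma is_derive_line (R : realType) (V : normedModType R) (h : V -> R) (y v : V) (c t l : R) :
  is_derive (y + (t * c) *: v) v h l ->
  is_derive t 1 (fun s => h (y + (s * c) *: v)) (l * c).
Proof.
move=> /is_derive_lineP hl.
apply: (@is_derive1_comp _ (fun s => h (y + s *: v)) (fun s => s * c)).
have -> : (fun s => s * c) = c \*: (id : R -> R) by apply/funext => s; rewrite mulrC.
by apply: is_derive_eq; exact: mulr1.
Qed.

(** The increment along s (w + c v) is split into a step s w followed by a step s c v. By the mean
    value theorem the second is s c times a v-derivative at a point close to x, so continuity of
    that one derivative at x is enough. *)
Lemma is_derive_add_dir (R : realType) (V : normedModType R) (h : V -> R)
    (x w v : V) (c l : R) :
  (forall y, derivable h y v) -> {for x, continuous (fun y => 'D_v h y)} ->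
  is_derive x w h l -> is_derive x (w + c *: v) h (l + 'D_v h x * c).
Proof.
move=> hv hc [hw hl].
have key : (fun s : R => s^-1 *: (h (s *: w + x + (s * c) *: v) - h (s *: w + x)))
    @ 0^' --> 'D_v h x * c.
  apply/cvgrPdist_le => e e0.
  (* [M] bounds the norm of w + t c v for t in [0, 1]; the 1 makes it positive. *)
  pose M := `|w| + `|c| * `|v| + 1.
  have M0 : 0 < M by rewrite ltr_pwDr// addr_ge0// mulr_ge0.
  have c10 : 0 < `|c| + 1 by rewrite ltr_wpDl.
  have e1 : 0 < e / (`|c| + 1) by rewrite divr_gt0.
  move/cvgrPdist_le : hc => /(_ _ e1).
  move=> /nbhs_normP[d /= d0 hd]; near=> s.
  have s0 : s != 0 by near: s; exact: nbhs_dnbhs_neq.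
  have sd : `|s| * M < d.
    rewrite -ltr_pdivlMr//; near: s; apply: dnbhs0_lt; exact: divr_gt0.
  have [] := @mvt_cc R (fun t => h (s *: w + x + (t * (s * c)) *: v))
    (fun t => 'D_v h (s *: w + x + (t * (s * c)) *: v) * (s * c)) 0 1 ler01.
    by move=> t _; apply: is_derive_line; apply: DeriveDef.
  move=> t /andP[t0 t1]; rewrite mul1r mul0r scale0r addr0 subr0 mulr1 => ->.
  set z := derive h (_ + _) v.
  rewrite [X in _ - X](_ : _ = z * c); last first.
    transitivity (s^-1 * (z * (s * c))); first by [].
    by rewrite (mulrCA z) mulKf.
  rewrite -mulrBl normrM; apply: (@le_trans _ _ (e / (`|c| + 1) * `|c|)).
    rewrite ler_wpM2r//; apply: hd => /=.
    have -> : x - (s *: w + x + (t * (s * c)) *: v) = - (s *: (w + (t * c) *: v)).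
      rewrite scalerDr scalerA (mulrCA s) -opprB; congr (- _).
      by rewrite addrAC addrK.
    rewrite normrN normrZ (le_lt_trans _ sd)// ler_wpM2l//.
    rewrite (le_trans (ler_normD _ _))// /M -addrA lerD2l normrZ normrM (ger0_norm t0).
    rewrite ler_wpDr// ler_wpM2r// ler_piMl//.
  by rewrite mulrAC ler_pdivrMr// ler_wpM2l ?(ltW e0)// lerDl.
have E : (fun r : R => r^-1 *: ((h \o shift x) (r *: (w + c *: v)) - h x)) =
   (fun r : R => r^-1 *: (h (r *: w + x + (r * c) *: v) - h (r *: w + x))) +
   (fun r : R => r^-1 *: ((h \o shift x) (r *: w) - h x)).
  apply/funext => r /=; rewrite fctE -scalerDr addrA subrK.
  by congr (_ *: (h _ - _)); rewrite scalerDr scalerA addrAC.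
have cv : (fun r : R => r^-1 *: ((h \o shift x) (r *: (w + c *: v)) - h x)) @ 0^'
   --> l + 'D_v h x * c.
  by rewrite E [l + _]addrC; apply: cvgD key _; rewrite -hl; exact: hw.
by split; [apply/cvg_ex; exists (l + 'D_v h x * c)|apply: cvg_lim].
Unshelve. all: by end_near. Qed.

Lemma is_derive0_dir (R : realType) (V : normedModType R) (h : V -> R) (x : V) :
  is_derive x 0 h 0.
Proof.
have E : (fun r : R => r^-1 *: ((h \o shift x) (r *: 0) - h x)) = cst 0.
  by apply/funext => r /=; rewrite scaler0 add0r subrr scaler0.
by split; rewrite /derivable /derive E; [exact: is_cvg_cst|exact: lim_cst].
Qed.

Lemma is_derive_grad (R : realType) n (h : 'rV[R]_n -> R) (x w : 'rV[R]_n) :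
  (forall i x, derivable h x (delta_mx 0 i)) ->
  (forall i, continuous (partial_d i h)) ->
  is_derive x w h (\sum_i w 0 i * partial_d i h x).
Proof.
move=> hd hc; rewrite {1}(row_sum_delta w); elim: (index_enum _) => [|i s IH].
  by rewrite !big_nil; exact: is_derive0_dir.
rewrite !big_cons addrC [X in is_derive _ _ _ X]addrC mulrC.
by apply: is_derive_add_dir => //; exact: hc.
Qed.

Lemma normr_delta (R : realType) n (i : 'I_n) : `|delta_mx 0 i : 'rV[R]_n| <= 1.
Proof.
rewrite [leLHS]mx_normrE; apply: bigmax_le => // -[a b] _ /=.
by rewrite mxE; case: (_ && _); rewrite ?normr1 ?normr0.
Qed.

(** The mean value theorem in direction i, then in direction j. The second difference is symmetric
    in i and j, so the lemma applied both ways equates the two mixed derivatives at points near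
    x. *)
Lemma second_difference (R : realType) n (u : 'rV[R]_n -> R) (i j : 'I_n) (x : 'rV[R]_n) t :
  0 <= t -> (forall x, derivable u x (delta_mx 0 i)) ->
  (forall x, derivable (partial_d i u) x (delta_mx 0 j)) ->
  exists2 ab : R * R, 0 <= ab.1 <= t /\ 0 <= ab.2 <= t &
   u (x + t *: delta_mx 0 i + t *: delta_mx 0 j) - u (x + t *: delta_mx 0 i)
   - (u (x + t *: delta_mx 0 j) - u x) =
   t ^+ 2 * partial_d j (partial_d i u) (x + ab.1 *: delta_mx 0 i + ab.2 *: delta_mx 0 j).
Proof.
move=> t0 hu hu2; set ei := delta_mx 0 i; set ej := delta_mx 0 j.
have [|a at_ ea] := @mvt_cc R (fun s => u (x + t *: ej + s *: ei) - u (x + s *: ei))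
   (fun s => partial_d i u (x + t *: ej + s *: ei) - partial_d i u (x + s *: ei)) 0 t t0.
  move=> s _.
  have /is_derive_lineP d1 : is_derive (x + t *: ej + s *: ei) ei u
    (partial_d i u (x + t *: ej + s *: ei)) by apply: DeriveDef.
  have /is_derive_lineP d2 : is_derive (x + s *: ei) ei u
    (partial_d i u (x + s *: ei)) by apply: DeriveDef.
  exact: (is_deriveB d1 d2).
have [|b bt eb] := @mvt_cc R (fun s => partial_d i u (x + a *: ei + s *: ej))
   (fun s => partial_d j (partial_d i u) (x + a *: ei + s *: ej)) 0 t t0.
  move=> s _.
  have : is_derive (x + a *: ei + s *: ej) ej (partial_d i u)
    (partial_d j (partial_d i u) (x + a *: ei + s *: ej)) by apply: DeriveDef.
  by move/is_derive_lineP.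
exists (a, b) => //=; move: ea eb; rewrite !scale0r !addr0 !subr0.
rewrite (addrAC x _ (t *: ei)) (addrAC x _ (a *: ei)) => -> ->.
by rewrite -mulrA -expr2 mulrC.
Qed.

Lemma ge_min_l (R : realDomainType) (x y : R) : Num.min x y <= x.
Proof. by rewrite ge_min lexx. Qed.

Lemma ge_min_r (R : realDomainType) (x y : R) : Num.min x y <= y.
Proof. by rewrite ge_min lexx orbT. Qed.

Lemma schwarz (R : realType) n (u : 'rV[R]_n -> R) (i j : 'I_n) (x : 'rV[R]_n) :
  C2 u -> partial_d i (partial_d j u) x = partial_d j (partial_d i u) x.
Proof.
move=> [_ u1 _ u2 u2c].
suff near_eq e : 0 < e ->
    `|partial_d i (partial_d j u) x - partial_d j (partial_d i u) x| <= e + e.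
  apply/eqP; rewrite -subr_eq0 -normr_eq0 eq_le normr_ge0 andbT.
  apply/ler_addgt0Pr => e e0; rewrite add0r (splitr e); apply: near_eq.
  by rewrite divr_gt0.
move=> e0.
have /cvgrPdist_le/(_ e e0)/nbhs_normP[d1 /= d10 h1] := u2c i j x.
have /cvgrPdist_le/(_ e e0)/nbhs_normP[d2 /= d20 h2] := u2c j i x.
(* The intermediate points are at distance at most 2 t from x, hence the division by 3. *)
pose t := Num.min d1 d2 / 3.
have m0 : 0 < Num.min d1 d2 by rewrite lt_min d10.
have t0 : 0 < t by rewrite divr_gt0.
have small p q (a b : R) : 0 <= a <= t -> 0 <= b <= t ->
    `|x - (x + a *: delta_mx 0 p + b *: delta_mx 0 q)| < Num.min d1 d2.
  move=> /andP[a0 a_t] /andP[b0 b_t].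
  rewrite -addrA opprD addNKr normrN.
  apply: (@le_lt_trans _ _ (t + t)); last by rewrite /t; move: m0; lra.
  rewrite (le_trans (ler_normD _ _))// !normrZ !ger0_norm//.
  have sc (c : R) q' : 0 <= c -> c <= t -> c * `|delta_mx 0 q' : 'rV[R]_n| <= t.
    by move=> c0 ct; apply: le_trans ct; rewrite ler_piMr// normr_delta.
  by rewrite lerD// sc.
have [[a b] [/= ha hb] E1] := @second_difference _ _ u i j x t (ltW t0) (u1 i) (u2 i j).
have [[a' b'] [/= ha' hb'] E2] := @second_difference _ _ u j i x t (ltW t0) (u1 j) (u2 j i).
have {E1 E2} E : partial_d j (partial_d i u) (x + a *: delta_mx 0 i + b *: delta_mx 0 j)
   = partial_d i (partial_d j u) (x + a' *: delta_mx 0 j + b' *: delta_mx 0 i).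
  apply: (@mulfI _ (t ^+ 2)); first by rewrite expf_neq0// gt_eqF.
  apply: etrans (esym E1) (etrans _ E2).
  rewrite (addrAC x (t *: delta_mx 0 j) (t *: delta_mx 0 i)).
  set p := u _; set q := u _; set r := u _; set s := u x.
  by rewrite !opprD !opprK !addrA (addrAC p).
have k1 := h1 _ (lt_le_trans (small i j _ _ ha hb) (ge_min_l _ _)).
have k2 := h2 _ (lt_le_trans (small j i _ _ ha' hb') (ge_min_r _ _)).
rewrite /= in k1 k2; rewrite -E in k2; rewrite distrC in k1.
rewrite -(subrKA (partial_d j (partial_d i u) (x + a *: delta_mx 0 i + b *: delta_mx 0 j))).
exact: le_trans (ler_normD _ _) (lerD k2 k1).
Qed.

Lemma second_derivative_test (R : realType) (f df : R -> R) (c d : R) :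
  0 < d -> (forall t : R, - d < t < d -> is_derive t 1 f (df t)) ->
  is_derive (0 : R) 1 df c -> (forall t, - d < t < d -> f t <= f 0) ->
  df 0 = 0 /\ c <= 0.
Proof.
move=> d0 fd dfd fmax.
have z_in : - d < 0 < d by rewrite oppr_lt0 d0.
have df0 : df 0 = 0.
  have h : is_derive (0 : R) 1 f 0.
    apply: (@derive1_at_max _ f (- d) d 0); rewrite ?in_itv//=; first lra.
    by move=> t; rewrite in_itv/= => td; have := fd t td => -[].
  by rewrite -(@derive_val _ _ _ _ _ _ _ (fd 0 z_in)) (@derive_val _ _ _ _ _ _ _ h).
split=> //; rewrite leNgt; apply/negP => c0.
have [dfc dfl] := dfd.
have cv : (fun h : R => h^-1 *: ((df \o shift 0) (h *: (1 : R)) - df 0)) @ 0^' --> c.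
  by rewrite -dfl; exact: dfc.
move/cvgrPdist_lt : cv => /(_ c c0)/nbhs_ballP[e /= e0 he].
have df_pos t : 0 < t < e -> 0 < df t.
  move=> /andP[t0 te]; have := he t; rewrite /ball/= sub0r normrN gtr0_norm// => /(_ te).
  rewrite gt_eqF// => /(_ isT); rewrite df0 subr0 addr0 [t *: (1 : R)]mulr1.
  move=> h; have : 0 < t^-1 * df t by move: h; rewrite ltr_norml => /andP[_]; rewrite ltrBlDr ltrDl.
  by rewrite pmulr_rgt0// invr_gt0.
pose h := Num.min d e / 2.
have m0 : 0 < Num.min d e by rewrite lt_min d0.
have md : Num.min d e <= d by exact: ge_min_l.
have me : Num.min d e <= e by exact: ge_min_r.
have h0 : 0 < h by rewrite divr_gt0.
have hm : h < Num.min d e by rewrite /h; move: m0; lra.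
(* The open interval matters: [df] is known to be positive only to the right of 0. *)
have [c' cin E] : exists2 x, x \in `]0, h[%R & f h - f 0 = df x * (h - 0).
  apply: MVT => // [t|].
    by rewrite in_itv/= => /andP[t0 th]; apply: fd; lra.
  apply: derivable_within_continuous => t; rewrite in_itv/= => /andP[t0 th].
  by apply: ex_derive; apply: fd; lra.
have hd : - d < h < d by lra.
have := fmax h hd; rewrite leNgt => /negP; apply.
rewrite -subr_gt0 E subr0 mulr_gt0// df_pos//.
by move: cin; rewrite in_itv/= => /andP[-> ch]; lra.
Qed.

Lemma is_derive_comp_dir (R : realType) (V : normedModType R) (psi : R -> R)
    (h : V -> R) (x w : V) (m l : R) :
  is_derive (h x) 1 psi m -> is_derive x w h l -> is_derive x w (psi \o h) (m * l).
Proof.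
have x0 : x = x + 0 *: w by rewrite scale0r addr0.
rewrite {2 3}x0 => pm /is_derive_lineP hl; apply/is_derive_lineP.
apply: (@is_derive1_comp _ psi (fun s => h (x + s *: w))) => //.
by rewrite scale0r addr0.
Qed.

Lemma is_derive_coord (R : realType) n (i : 'I_n) (x w : 'rV[R]_n) :
  is_derive x w (fun y : 'rV[R]_n => y 0 i) (w 0 i).
Proof.
have E : (fun h : R => h^-1 *: (((fun y : 'rV[R]_n => y 0 i) \o shift x) (h *: w) - x 0 i))
   @ 0^' --> w 0 i.
  apply: cvg_near_cst; near=> h; rewrite /= !mxE addrK.
  have h0 : h != 0 by near: h; exact: nbhs_dnbhs_neq.
  by transitivity (h^-1 * (h * w 0 i)) => //; rewrite mulKf.
by split; [apply/cvg_ex; exists (w 0 i)|exact: cvg_lim].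
Unshelve. all: by end_near. Qed.

Lemma is_derive_lincomb (R : realType) (V : normedModType R) n (c : 'I_n -> R)
    (h : 'I_n -> V -> R) (x w : V) (l : 'I_n -> R) :
  (forall i, is_derive x w (h i) (l i)) ->
  is_derive x w (fun y => \sum_i c i * h i y) (\sum_i c i * l i).
Proof.
move=> hl; have -> : (fun y => \sum_i c i * h i y) = \sum_i (c i \*: h i).
  by apply/funext => y; rewrite fct_sumE.
exact: is_derive_sum.
Qed.

Lemma C2_second_derivative (R : realType) n (u : 'rV[R]_n -> R) (x w : 'rV[R]_n) :
  C2 u ->
  (forall t : R, is_derive t 1 (fun s => u (x + s *: w))
      (\sum_i w 0 i * partial_d i u (x + t *: w))) /\
  is_derive (0 : R) 1 (fun s => \sum_i w 0 i * partial_d i u (x + s *: w))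
     ((w *m hess u x *m w^T) 0 0).
Proof.
move=> [_ u1 u1c u2 u2c]; split.
  move=> t; have := @is_derive_grad _ _ u (x + t *: w) w u1 u1c.
  by move/is_derive_lineP.
suff : is_derive (x + 0 *: w) w (fun y => \sum_i w 0 i * partial_d i u y)
    ((w *m hess u x *m w^T) 0 0) by move/is_derive_lineP.
rewrite scale0r addr0.
have -> : (w *m hess u x *m w^T) 0 0 =
    \sum_i w 0 i * \sum_j w 0 j * partial_d j (partial_d i u) x.
  rewrite mxE; apply: eq_bigr => i _; rewrite !mxE mulrC; congr (_ * _).
  by apply: eq_bigr => j _; rewrite mxE.
apply: is_derive_lincomb => i.
exact: (@is_derive_grad _ _ (partial_d i u) x w (u2 i) (u2c i)).
Qed.

Definition quad (R : realType) n (s0 A : R) (x : 'rV[R]_n) : R :=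
  s0 + A / 2 * (x *m x^T) 0 0.

Lemma is_derive_quad (R : realType) n (s0 A : R) (x w : 'rV[R]_n) :
  is_derive x w (quad s0 A) (A * (x *m w^T) 0 0).
Proof.
have h i : is_derive x w (fun y : 'rV[R]_n => y 0 i ^+ 2) (x 0 i * w 0 i *+ 2).
  have hi := is_derive_coord i x w.
  have hh := is_deriveM hi hi; apply: (is_derive_eq hh).
  by rewrite mulr2n; congr (_ + _).
have := is_derive_lincomb (fun=> A / 2) h.
move=> /(is_deriveD (is_derive_cst s0 x w)).
have -> : cst s0 + (fun y : 'rV[R]_n => \sum_i A / 2 * y 0 i ^+ 2) = quad s0 A.
  apply/funext => y; rewrite /quad mxE mulr_sumr; congr (_ + _).
  by apply: eq_bigr => i _; rewrite mxE.
move=> hh; apply: (is_derive_eq hh); rewrite add0r mxE mulr_sumr; apply: eq_bigr => i _.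
by rewrite mxE; field.
Qed.

Lemma is_derive_radial (R : realType) n (psi p : R -> R) (s0 A : R) (x w : 'rV[R]_n) :
  is_derive (quad s0 A x) 1 psi (p (quad s0 A x)) ->
  is_derive x w (psi \o quad s0 A) (p (quad s0 A x) * (A * (x *m w^T) 0 0)).
Proof. by move=> hp; exact: (is_derive_comp_dir hp (is_derive_quad s0 A x w)). Qed.

Lemma is_derive2_radial (R : realType) n (p : R -> R) (q s0 A : R) (x w z : 'rV[R]_n) :
  is_derive (quad s0 A x) 1 p q ->
  is_derive x w (fun y => p (quad s0 A y) * (A * (y *m z^T) 0 0))
    (A * p (quad s0 A x) * (w *m z^T) 0 0
      + A ^+ 2 * q * ((x *m w^T) 0 0 * (x *m z^T) 0 0)).
Proof.
move=> hq.
have h1 : is_derive x w (p \o quad s0 A) (q * (A * (x *m w^T) 0 0)).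
  exact: (is_derive_comp_dir hq (is_derive_quad s0 A x w)).
have h2 : is_derive x w (fun y : 'rV[R]_n => A * (y *m z^T) 0 0) (A * (w *m z^T) 0 0).
  have := is_derive_lincomb (fun i => A * z 0 i) (fun i => is_derive_coord i x w).
  have -> : (fun y : 'rV[R]_n => \sum_i A * z 0 i * y 0 i) = (fun y => A * (y *m z^T) 0 0).
    apply/funext => y; rewrite mxE mulr_sumr; apply: eq_bigr => i _.
    by rewrite mxE; ring.
  move=> hh; apply: (is_derive_eq hh); rewrite mxE mulr_sumr; apply: eq_bigr => i _.
  by rewrite mxE; ring.
have hh := is_deriveM h1 h2; apply: (is_derive_eq hh).
rewrite /=; set a := p _; set b := (w *m _) 0 0; set c := (x *m w^T) 0 0.
set d := (x *m z^T) 0 0.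
by transitivity (a * (A * b) + A * d * (q * (A * c))) => //; ring.
Qed.

(** * The profile and the Keller-Osserman integral *)

Lemma is_derive1_continuous (R : realType) (f : R -> R) (x l : R) :
  is_derive x 1 f l -> {for x, continuous f}.
Proof. by move=> fl; apply/differentiable_continuous/derivable1_diffP. Qed.

Lemma is_derive_le (R : realType) (f df g dg : R -> R) (a b : R) : a <= b ->
  (forall t, a <= t <= b -> is_derive t 1 f (df t)) ->
  (forall t, a <= t <= b -> is_derive t 1 g (dg t)) ->
  (forall t, a <= t <= b -> df t <= dg t) -> f b - f a <= g b - g a.
Proof.
move=> ab hf hg fg.
have [t tab] := @mvt_cc R (g - f) (fun t => dg t - df t) a b ab
  (fun t tab => is_deriveB (hg t tab) (hf t tab)).
rewrite !fctE => E; have : 0 <= (dg t - df t) * (b - a).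
  by rewrite mulr_ge0 ?subr_ge0// fg.
by rewrite -E; lra.
Qed.

Lemma is_derive_Rintegral (R : realType) (g : R -> R) (b u : R) :
  continuous g -> b < u ->
  is_derive u 1 (fun x => \int[lebesgue_measure]_(t in `[b, x]) g t)%R (g u).
Proof.
move=> gc bu; have uu : u < u + 1 by rewrite ltrDl.
have := @continuous_FTC1_closed R g b u (u + 1) uu.
move=> /(_ _ bu (gc u)) [|d e].
  apply: continuous_compact_integrable; first exact: segment_compact.
  exact: continuous_subspaceT.
by split; [exact: d|rewrite -derive1E; exact: e].
Qed.

(** g is frozen to the left of the midpoint m of c and c1, which makes it continuous on the whole
    line. Integrating from m < c1 gives a two-sided derivative at c1 as well. *)
Lemma exists_primitive (R : realType) (g : R -> R) (c c1 : R) : c < c1 ->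
  (forall u, c < u -> {for u, continuous g}) ->
  exists K : R -> R, K c1 = 0 /\ forall u, c1 <= u -> is_derive u 1 K (g u).
Proof.
move=> cc1 gc; pose m := (c + c1) / 2.
have [cm mc] : c < m /\ m < c1 by rewrite /m; split; lra.
pose gt t := g (Num.max m t).
have gtc : continuous gt.
  move=> t; apply: continuous_comp; last by apply: gc; rewrite lt_max cm.
  by apply: continuous_max; [exact: cvg_cst|exact: cvg_id].
pose P x := (\int[lebesgue_measure]_(t in `[m, x]) gt t)%R.
exists (fun x => P x - P c1); split; first by rewrite subrr.
move=> u cu; have mu : m < u by exact: lt_le_trans cu.
have hP := is_derive_Rintegral gtc mu.
have hh := is_deriveB hP (is_derive_cst (P c1) u 1).
by apply: (is_derive_eq hh); rewrite subr0 /gt max_r// ltW.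
Qed.

Section InverseFlow.
Variables (R : realType) (G K : R -> R) (c1 : R).
Hypothesis G_gt0 : forall u, c1 <= u -> 0 < G u.
Hypothesis K_derive : forall u, c1 <= u -> is_derive u 1 K (G u)^-1.

Lemma flow_lt u v : c1 <= u -> u < v -> K u < K v.
Proof.
move=> cu uv; have [|t /andP[ut tv] E] := @mvt_cc R K (fun t => (G t)^-1) u v (ltW uv).
  by move=> t /andP[ut _]; apply: K_derive; exact: le_trans ut.
by rewrite -subr_gt0 E mulr_gt0 ?subr_gt0// invr_gt0 G_gt0// (le_trans cu).
Qed.

(** The inverse of K on [c1, +oo[. Since K' = 1/G, it solves psi' = G psi, by separation of
    variables. *)
Definition flow (s : R) : R := xget c1 [set u | c1 <= u /\ K u = s].

Lemma flowK u : c1 <= u -> flow (K u) = u.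
Proof.
move=> cu; rewrite /flow; case: xgetP => [v _ [cv Kv]|/(_ u)]; last by case.
by have [vu|uv|//] := ltgtP v u;
  [have := flow_lt cv vu|have := flow_lt cu uv]; rewrite Kv ltxx.
Qed.

(** The solution lives as long as s stays below some value of K: for all time if K is unbounded, up
    to the supremum of K otherwise. *)
Lemma flow_spec s u : K c1 < s -> c1 <= u -> s < K u ->
  [/\ c1 < flow s, flow s < u, K (flow s) = s & is_derive s 1 flow (G (flow s))].
Proof.
move=> s0 cu su.
have Kc : {within `[c1, u], continuous K}.
  apply: derivable_within_continuous => t; rewrite in_itv/= => /andP[ct _].
  by apply: ex_derive; exact: K_derive.
have [v vin Kv] : exists2 v, v \in `[c1, u]%R & K v = s.
  apply: IVT => //; rewrite ge_min le_max (ltW s0) (ltW su) orbT//.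
move: vin; rewrite in_itv/= => /andP[cv vu].
have fs : flow s = v by rewrite -Kv flowK.
rewrite fs Kv; have cv' : c1 < v.
  by rewrite lt_neqAle cv andbT; apply: contraTneq s0 => ->; rewrite Kv ltxx.
split => //.
  by rewrite lt_neqAle vu andbT; apply: contraTneq su => <-; rewrite Kv ltxx.
rewrite -{1}Kv -[G v]invrK; apply: is_derive_inverse.
- near=> w; apply: flowK; apply: ltW; near: w; exact: lt_nbhsr.
- near=> w; apply: (@is_derive1_continuous _ K w (G w)^-1); apply: K_derive; apply: ltW.
  by near: w; exact: lt_nbhsr.
- exact: K_derive.
- by rewrite gt_eqF// invr_gt0 G_gt0.
Unshelve. all: by end_near. Qed.

End InverseFlow.

Lemma improper_integral_bounded (R : realType) (g K : R -> R) (a : R) :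
  (forall u, a <= u -> 0 <= g u) -> (forall u, a <= u -> {for u, continuous g}) ->
  (forall u, a <= u -> is_derive u 1 K (g u)) ->
  (\int[lebesgue_measure]_(t in `[a, +oo[) (g t)%:E < +oo)%E <->
  exists M, forall u, a <= u -> K u <= M.
Proof.
move=> g0 gc Kd.
have Knd u v : a <= u -> u <= v -> K u <= K v.
  move=> au uv; rewrite -subr_ge0.
  have [|t /andP[ut _] ->] := @mvt_cc R K g u v uv.
    by move=> t /andP[ut _]; apply: Kd; exact: le_trans ut.
  by rewrite mulr_ge0 ?subr_ge0// g0// (le_trans au).
have gw : {within `[a, +oo[, continuous g}.
  by apply/continuous_in_subspaceT => x; rewrite inE/= in_itv/= andbT; exact: gc.
split=> [KO|[M KM]].
  exists (fine (\int[lebesgue_measure]_(t in `[a, +oo[) (g t)%:E)%E + K a) => u au.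
  rewrite -lerBlDr -lee_fin fineK; last first.
    by rewrite ge0_fin_numE// integral_ge0// => x; rewrite /= in_itv/= andbT lee_fin; exact: g0.
  have [->|ua] := eqVneq u a.
    rewrite subrr; apply: integral_ge0 => x.
    by rewrite /= in_itv/= andbT lee_fin; exact: g0.
  have {}au : a < u by rewrite lt_neqAle eq_sym ua.
  have Kc x : a <= x -> {for x, continuous K}.
    by move=> /Kd; exact: is_derive1_continuous.
  rewrite EFinB.
  have <- : (\int[lebesgue_measure]_(t in `[a, u]) (g t)%:E = (K u)%:E - (K a)%:E)%E.
    apply: continuous_FTC2 => //.
    - apply/continuous_in_subspaceT => x; rewrite inE/= in_itv/= => /andP[ax _].
      exact: gc.
    - split=> [x||].
      + by rewrite in_itv/= => /andP[/ltW/Kd xa _]; exact: ex_derive.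
      + by apply: cvg_at_right_filter; exact: Kc.
      + by apply: cvg_at_left_filter; apply: Kc; exact: ltW.
    - move=> x; rewrite in_itv/= => /andP[/ltW/Kd xa _].
      by rewrite derive1E derive_val.
  apply: ge0_subset_integral => //=.
  - by apply/measurable_EFinP; apply: subspace_continuous_measurable_fun.
  - by move=> x; rewrite /= in_itv/= andbT lee_fin; exact: g0.
  - by apply: subset_itvl; rewrite bnd_simp.
(* K is monotone only on [a, +oo[; this extension is monotone on the whole line, so its limit at
   infinity is the supremum of its range. *)
pose k x := K (Num.max a x).
have am x : a <= Num.max a x by rewrite le_max lexx.
have kl : k x @[x --> +oo] --> sup (range k).
  apply: nondecreasing_cvgr; last by exists M => _ [x _ <-]; apply: KM; exact: am.
  by move=> x y xy; apply: Knd => //; rewrite ge_max am/= le_max xy orbT.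
rewrite (@ge0_continuous_FTC2y R g K a (sup (range k))) //.
- by rewrite -EFinB ltry.
- apply: cvg_trans kl; apply: near_eq_cvg; near=> x.
  rewrite /k max_r//; near: x; exact: nbhs_pinfty_ge.
- by move=> x /ltW/Kd xa; exact: ex_derive.
- by apply: cvg_at_right_filter; apply: is_derive1_continuous; apply: Kd.
- by move=> x; rewrite in_itv/= andbT => /ltW/Kd xa; rewrite derive1E derive_val.
Unshelve. all: by end_near. Qed.

Section KellerOsserman.
Variables (R : realType) (k : nat) (f : R -> R).
Hypotheses (f_cont : continuous f) (f_pos : forall t : R, 0 < f t)
  (f_mono : forall s t : R, s <= t -> f s <= f t).

(** The base point is 0 in the Keller-Osserman integral and for the subsolution. For the
    supersolution it must lie below the value of u at the origin, which may be negative. *)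
Definition Fint (b u : R) : R := (\int[lebesgue_measure]_(t in `[b, u]) (f t ^+ k))%R.

Let fk_cont : continuous (fun t => f t ^+ k).
Proof. move=> t; apply: (@continuous_comp _ _ _ f (fun x : R => x ^+ k)); first exact: f_cont.
exact: exprn_continuous. Qed.

Lemma fk_gt0 t : 0 < f t ^+ k. Proof. exact: exprn_gt0. Qed.

Lemma fk_mono s t : s <= t -> f s ^+ k <= f t ^+ k.
Proof. by move=> st; rewrite lerXn2r ?nnegrE ?(ltW (f_pos _)) ?f_mono. Qed.

Lemma Fint_derive (b u : R) : b < u -> is_derive u 1 (Fint b) (f u ^+ k).
Proof. by move=> bu; exact: (is_derive_Rintegral fk_cont bu). Qed.

Lemma Fint_gt0 (b u : R) : b < u -> 0 < Fint b u.
Proof.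
(* [Fint_derive] holds only to the right of b, so the mean value theorem starts at the midpoint. *)
move=> bu; pose m := (b + u) / 2.
have [bm mu] : b < m /\ m < u by rewrite /m; split; lra.
have [|t _ E] := @mvt_cc R (Fint b) (fun t => f t ^+ k) m u (ltW mu).
  by move=> t /andP[mt _]; apply: Fint_derive; exact: lt_le_trans mt.
have h0 : 0 <= Fint b m by apply: Rintegral_ge0 => x _; exact/ltW/fk_gt0.
have := fk_gt0 t; move: E; set p := Fint b u => E p0.
have : 0 < f t ^+ k * (u - m) by rewrite mulr_gt0// subr_gt0.
by rewrite -E; lra.
Qed.

Lemma Fint_base (b u : R) : b <= 0 -> Fint 0 u <= Fint b u.
Proof.
move=> b0.
have int c : lebesgue_measure.-integrable `[c, u] (EFin \o (fun t => f t ^+ k)).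
  apply: continuous_compact_integrable; first exact: segment_compact.
  exact: continuous_subspaceT.
apply: fine_le; [exact: integrable_fin_num|exact: integrable_fin_num|].
apply: ge0_subset_integral => //=.
- exact: (measurable_int _ (int b)).
- by move=> x _; rewrite lee_fin ltW// fk_gt0.
- by apply: subset_itvr; rewrite bnd_simp.
Qed.

Definition Wfun (b u : R) : R := Fint b u `^ k.+1%:R^-1.

Definition dWfun (b u : R) : R :=
  k.+1%:R^-1 * Fint b u `^ (k.+1%:R^-1 - 1) * f u ^+ k.

Lemma Wfun_gt0 (b u : R) : b < u -> 0 < Wfun b u.
Proof. by move=> bu; apply: powR_gt0; exact: Fint_gt0. Qed.

Lemma Wfun_derive (b u : R) : b < u -> is_derive u 1 (Wfun b) (dWfun b u).
Proof.
move=> bu.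
exact: (is_derive1_comp (is_derive1_powR k.+1%:R^-1 (Fint_gt0 bu)) (Fint_derive bu)).
Qed.

Lemma dWfun_ge0 (b u : R) : 0 <= dWfun b u.
Proof. by rewrite !mulr_ge0 ?invr_ge0 ?powR_ge0 ?exprn_ge0// ltW. Qed.

Lemma Wfun_continuous (b u : R) : b < u -> {for u, continuous (Wfun b)}.
Proof. by move=> /Wfun_derive; exact: is_derive1_continuous. Qed.

Lemma dWfun_continuous (b u : R) : b < u -> {for u, continuous (dWfun b)}.
Proof.
move=> bu; apply: continuousM; last exact: fk_cont.
apply: continuousM; first exact: cst_continuous.
have h := is_derive1_comp (is_derive1_powR (k.+1%:R^-1 - 1) (Fint_gt0 bu)) (Fint_derive bu).
exact: (is_derive1_continuous h).
Qed.

Lemma Wfun_pow (b u : R) : b < u -> Wfun b u ^+ k.+1 = Fint b u.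
Proof.
move=> bu; rewrite -powR_mulrn ?powR_ge0// /Wfun -powRrM mulVf ?pnatr_eq0//.
by rewrite powRr1// ltW// Fint_gt0.
Qed.

Lemma dWfun_pow (b u : R) : b < u -> dWfun b u * Wfun b u ^+ k = f u ^+ k / k.+1%:R.
Proof.
move=> bu; rewrite -powR_mulrn ?powR_ge0// /Wfun -powRrM /dWfun mulrAC.
have F0 : Fint b u != 0 by rewrite gt_eqF// Fint_gt0.
rewrite -[_^-1 * _ * _ `^ _]mulrA -powRD ?F0 ?implybT//.
rewrite (_ : _ + _ = 0) ?powRr0 ?mulr1 1?mulrC//.
by rewrite -natr1; field; rewrite natr1 pnatr_eq0.
Qed.

Lemma Wfun_mono (b u v : R) : b < u -> u <= v -> Wfun b u <= Wfun b v.
Proof.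
move=> bu uv; rewrite -subr_ge0.
have [|t _ ->] := @mvt_cc R (Wfun b) (dWfun b) u v uv.
  by move=> t /andP[ut _]; apply: Wfun_derive; exact: lt_le_trans ut.
by rewrite mulr_ge0 ?dWfun_ge0// subr_ge0.
Qed.

Lemma KO_integral_bounded (a : R) (K : R -> R) : 0 < a ->
  (forall u, a <= u -> is_derive u 1 K (Wfun 0 u)^-1) ->
  (KO_integral k f a < +oo)%E <-> exists M, forall u, a <= u -> K u <= M.
Proof.
move=> a0 Kd; rewrite -(@improper_integral_bounded R (fun u => (Wfun 0 u)^-1)) //.
- rewrite /KO_integral; under eq_integral do rewrite powRN.
  by [].
- by move=> u au; rewrite invr_ge0 powR_ge0.
- move=> u au; apply: continuousV; first by rewrite gt_eqF// Wfun_gt0// (lt_le_trans a0).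
  by apply: Wfun_continuous; exact: lt_le_trans au.
Qed.

(* Either [Wfun 0 u] eventually exceeds [u], and then [K'] is at least half the
   Keller-Osserman integrand, or [Wfun 0 u <= u] for arbitrarily large [u], and then
   [K] gains at least 1/4 on each interval [[u/2, u]]. *)
Lemma KO_divergence (a : R) (K : R -> R) : 0 < a ->
  (forall u, a <= u -> is_derive u 1 K (Wfun 0 u + u)^-1) ->
  KO_integral k f a = +oo%E -> forall M, exists2 u, a <= u & M < K u.
Proof.
move=> a0 Kd KO M; apply: contrapT => /forall2NP noM.
have KM u : a <= u -> K u <= M.
  by move=> au; have [//|/negP] := noM u; rewrite -leNgt.
have W0 u : a <= u -> 0 < Wfun 0 u by move=> au; apply: Wfun_gt0; exact: lt_le_trans au.
have Kinc u v : a <= u -> u <= v -> (v - u) / (Wfun 0 v + v) <= K v - K u.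
  move=> au uv; have [|t /andP[ut tv] ->] := @mvt_cc R K (fun u => (Wfun 0 u + u)^-1) u v uv.
    by move=> t /andP[ut _]; apply: Kd; exact: le_trans ut.
  have at_ := le_trans au ut.
  have p0 w : a <= w -> 0 < Wfun 0 w + w.
    by move=> aw; rewrite addr_gt0 ?W0// (lt_le_trans a0).
  rewrite mulrC ler_wpM2r ?subr_ge0// lef_pV2 ?posrE ?p0//; last exact: le_trans au uv.
  exact: (lerD (Wfun_mono (lt_le_trans a0 at_) tv) tv).
have Kmono u v : a <= u -> u <= v -> K u <= K v.
  move=> au uv; rewrite -subr_ge0 (le_trans _ (Kinc u v au uv))//.
  have av := le_trans au uv; have v0 := lt_le_trans a0 av.
  by rewrite divr_ge0 ?subr_ge0// addr_ge0 ?(ltW v0)// ltW ?W0.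
have a20 : 0 < a / 2 by rewrite divr_gt0.
have [K0 [_ K0d]] := @exists_primitive R (fun u => (Wfun 0 u)^-1) (a / 2) a
   (ltac:(lra)) (fun u au => ltac:(apply: continuousV;
     [by rewrite gt_eqF// Wfun_gt0// (lt_trans a20)
     |by apply: Wfun_continuous; exact: lt_trans au])).
suff : (KO_integral k f a < +oo)%E by rewrite KO ltxx.
apply/(KO_integral_bounded a0 K0d).
have [[X aX XW]|nX] := pselect (exists2 X, a <= X & forall u, X <= u -> u < Wfun 0 u).
  exists (K0 X + 2 * (M - K X)) => u au.
  have K0mono v w : a <= v -> v <= w -> K0 v <= K0 w.
    move=> av vw; rewrite -subr_ge0.
    have [|t /andP[vt _] ->] := @mvt_cc R K0 (fun u => (Wfun 0 u)^-1) v w vw.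
      by move=> t /andP[vt _]; apply: K0d; exact: le_trans vt.
    by rewrite mulr_ge0 ?subr_ge0// invr_ge0 powR_ge0.
  have MX := KM X aX.
  have [uX|/ltW Xu] := leP u X; first by have := K0mono u X au uX; lra.
  have d2 t : X <= t <= u -> is_derive t 1 (fun t => 2 * K t) (2 * (Wfun 0 t + t)^-1).
    move=> /andP[Xt _]; have ht := Kd t (le_trans aX Xt).
    have hh := is_deriveZ 2 ht; exact: (is_derive_eq hh).
  have := @is_derive_le R K0 (fun u => (Wfun 0 u)^-1) (fun t => 2 * K t)
     (fun t => 2 * (Wfun 0 t + t)^-1) X u Xu
     (fun t h => K0d t (le_trans aX (proj1 (andP h)))) d2.
  have := KM u au => h1 /(_ _)/wrap[t /andP[Xt _]|]; last by lra.
  have := XW t Xt => tW; have t0 := lt_le_trans a0 (le_trans aX Xt).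
  rewrite -[leLHS]mul1r ler_pdivrMr ?(lt_trans t0)// mulrAC ler_pdivlMr ?addr_gt0//.
    by lra.
  exact: lt_trans tW.
exfalso.
have step X : a <= X -> exists2 Y, a <= Y & K X + 4^-1 <= K Y.
  move=> aX; have X0 := lt_le_trans a0 aX.
  (* Starting from 2 X keeps u / 2 above X, so that K (u / 2) is at least K X. *)
  have [u Xu Wu] : exists2 u, 2 * X <= u & Wfun 0 u <= u.
    apply: contrapT => h; apply: nX; exists (2 * X); first lra.
    by move=> u Xu; rewrite ltNge; apply/negP => Wu; apply: h; exists u.
  exists u; first lra.
  have := Kinc (u / 2) u (ltac:(lra)) (ltac:(lra)).
  have := Kmono X (u / 2) aX (ltac:(lra)) => h1 h2.
  have : 4^-1 <= (u - u / 2) / (Wfun 0 u + u).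
    have u0 : 0 < Wfun 0 u + u by rewrite addr_gt0 ?W0//; lra.
    by rewrite ler_pdivlMr//; lra.
  lra.
have iter m : exists2 Y, a <= Y & K a + m%:R / 4 <= K Y.
  elim: m => [|m [Y aY hY]]; first by exists a; rewrite // mul0r addr0.
  have [Z aZ hZ] := step Y aY; exists Z => //; rewrite -natr1; lra.
have Ma : 0 <= 4 * (M - K a) by rewrite mulr_ge0// subr_ge0 KM.
have := archi_boundP Ma; have [Y aY hY] := iter (Num.bound (4 * (M - K a))).
by have := KM Y aY; lra.
Qed.

(** Lowering the base point below 0 enlarges [Fint] and so decreases the integrand; this comparison
    is made beyond max(a, c1), and below it K is controlled by monotonicity. *)
Lemma KO_convergence (a b c1 : R) (K : R -> R) : 0 < a -> b <= 0 -> b < c1 ->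
  (forall u, c1 <= u -> is_derive u 1 K (Wfun b u)^-1) ->
  (KO_integral k f a < +oo)%E -> exists M, forall u, c1 <= u -> K u <= M.
Proof.
move=> a0 b0 bc Kd KO.
have a20 : 0 < a / 2 by rewrite divr_gt0.
have [K0 [_ K0d]] := @exists_primitive R (fun u => (Wfun 0 u)^-1) (a / 2) a
   (ltac:(lra)) (fun u au => ltac:(apply: continuousV;
     [by rewrite gt_eqF// Wfun_gt0// (lt_trans a20)
     |by apply: Wfun_continuous; exact: lt_trans au])).
have [M K0M] := iffLR (KO_integral_bounded a0 K0d) KO.
pose e := Num.max a c1.
have ae : a <= e by rewrite le_max lexx.
have ce : c1 <= e by rewrite le_max lexx orbT.
have Kmono v w : c1 <= v -> v <= w -> K v <= K w.
  move=> av vw; rewrite -subr_ge0.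
  have [|t /andP[vt _] ->] := @mvt_cc R K (fun u => (Wfun b u)^-1) v w vw.
    by move=> t /andP[vt _]; apply: Kd; exact: le_trans vt.
  by rewrite mulr_ge0 ?subr_ge0// invr_ge0 powR_ge0.
exists (K e + (M - K0 e)) => u cu.
have Me := K0M e ae.
have [ue|/ltW eu] := leP u e; first by have := Kmono u e cu ue; lra.
have := @is_derive_le R K (fun u => (Wfun b u)^-1) K0 (fun u => (Wfun 0 u)^-1) e u eu
  (fun t h => Kd t (le_trans ce (proj1 (andP h))))
  (fun t h => K0d t (le_trans ae (proj1 (andP h)))).
have := K0M u (le_trans ae eu) => h1 /(_ _)/wrap[t /andP[et _]|]; last by lra.
have t0 : 0 < t := lt_le_trans a0 (le_trans ae et).
have bt := le_lt_trans b0 t0.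
rewrite lef_pV2 ?posrE; [|exact: (Wfun_gt0 bt)|exact: (Wfun_gt0 t0)].
apply: ge0_ler_powR; rewrite ?nnegrE; first by rewrite invr_ge0.
- exact: ltW (Fint_gt0 t0).
- exact: ltW (Fint_gt0 bt).
- exact: Fint_base.
Qed.

(** Bounds the part of [Sk] without a factor W'. As K' = 1/W and W is monotone, a bounded K gives u
    - c1 <= L W(u). Hence W^(k+1) = F(u) <= F(c1) + (u - c1) f(u)^k <= F(c1) + L W f^k, and dividing
    by W leaves a multiple of f^k; the constant [C'] absorbs F(c1). *)
Lemma Wfun_le_f (b c1 M : R) (K : R -> R) : b < c1 ->
  (forall u, c1 <= u -> is_derive u 1 K (Wfun b u)^-1) ->
  (forall u, c1 <= u -> K u <= M) ->
  exists2 C, 0 < C & forall u, c1 <= u -> Wfun b u ^+ k <= C * f u ^+ k.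
Proof.
move=> bc Kd KM; pose L := M - K c1.
have L0 : 0 <= L by rewrite subr_ge0 KM.
have Wc0 := Wfun_gt0 bc; have fc0 := fk_gt0 c1.
have Fc0 := Fint_gt0 bc.
pose C' := Fint b c1 / (Wfun b c1 * f c1 ^+ k).
have C'0 : 0 < C' by rewrite divr_gt0// mulr_gt0.
exists (C' + L); first by rewrite ltr_pwDl.
move=> u cu; have bu := lt_le_trans bc cu.
have W0 := Wfun_gt0 bu; have f0 := fk_gt0 u.
have uL : u - c1 <= L * Wfun b u.
  have [|t /andP[ct tu] E] := @mvt_cc R K (fun u => (Wfun b u)^-1) c1 u cu.
    by move=> t /andP[ct _]; exact: Kd.
  have Wt0 := Wfun_gt0 (lt_le_trans bc ct).
  have -> : u - c1 = (K u - K c1) * Wfun b t.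
    by rewrite E mulrAC (mulVf (lt0r_neq0 Wt0)) mul1r.
  apply: (@le_trans _ _ (L * Wfun b t)).
    exact: (ler_wpM2r (ltW Wt0) (lerB (KM u cu) (lexx _))).
  exact: (ler_wpM2l L0 (Wfun_mono (lt_le_trans bc ct) tu)).
have FF : Fint b u <= Fint b c1 + (u - c1) * f u ^+ k.
  have [|t /andP[ct tu] E] := @mvt_cc R (Fint b) (fun u => f u ^+ k) c1 u cu.
    by move=> t /andP[ct _]; apply: Fint_derive; exact: lt_le_trans ct.
  rewrite -lerBlDl E mulrC; apply: ler_wpM2l; first by rewrite subr_ge0.
  exact: fk_mono.
have FC : Fint b c1 <= C' * (Wfun b u * f u ^+ k).
  have h : Wfun b c1 * f c1 ^+ k <= Wfun b u * f u ^+ k.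
    exact: (ler_pM (ltW Wc0) (ltW fc0) (Wfun_mono bc cu) (fk_mono cu)).
  have -> : Fint b c1 = C' * (Wfun b c1 * f c1 ^+ k).
    exact: (esym (divfK (lt0r_neq0 (mulr_gt0 Wc0 fc0)) _)).
  exact: (ler_wpM2l (ltW C'0) h).
have uLf := ler_wpM2r (ltW f0) uL.
rewrite -(ler_pM2l W0) -exprS (Wfun_pow bu).
apply: (le_trans FF); apply: (le_trans (lerD FC uLf)).
by rewrite le_eqVlt; apply/orP; left; apply/eqP; ring.
Qed.

End KellerOsserman.

(** * Radial functions *)

Lemma dot_delta (R : realType) n (x : 'rV[R]_n) i :
  (x *m (delta_mx 0 i : 'rV[R]_n)^T) 0 0 = x 0 i.
Proof.
rewrite mxE (bigD1 i)//= big1 ?addr0; last first.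
  by move=> j ji; rewrite !mxE (negbTE ji) andbF mulr0.
by rewrite !mxE !eqxx mulr1.
Qed.

Lemma enorm_dot (R : realType) n (x : 'rV[R]_n) : enorm x = Num.sqrt ((x *m x^T) 0 0).
Proof. by rewrite /enorm mxE; congr Num.sqrt; apply: eq_bigr => i _; rewrite mxE. Qed.

Lemma enorm_sqr (R : realType) n (x : 'rV[R]_n) : enorm x ^+ 2 = (x *m x^T) 0 0.
Proof. by rewrite enorm_dot sqr_sqrtr// dot_ge0. Qed.

Lemma enorm_scale (R : realType) n (c : R) (x : 'rV[R]_n) :
  0 <= c -> enorm (c *: x) = c * enorm x.
Proof.
move=> c0; rewrite /enorm (eq_bigr (fun i => c ^+ 2 * x 0 i ^+ 2)).
  by rewrite -mulr_sumr sqrtrM ?exprn_ge0// sqrtr_sqr ger0_norm.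
by move=> i _; rewrite mxE exprMn.
Qed.

Lemma quad_continuous (R : realType) n (s0 A : R) :
  continuous (quad s0 A : 'rV[R]_n -> R).
Proof.
have -> : quad s0 A = (fun x : 'rV[R]_n => s0 + A / 2 * \sum_i x 0 i ^+ 2).
  apply/funext => x; rewrite /quad mxE; congr (_ + _ * _).
  by apply: eq_bigr => i _; rewrite mxE.
have sq : continuous (fun x : 'rV[R]_n => \sum_i x 0 i ^+ 2).
  apply: (@continuous_big R _ _ _ _ (@add_continuous R) 'rV[R]_n _
    (fun (i : 'I_n) x => x 0 i ^+ 2)) => i _ y.
  apply: (@continuous_comp _ _ _ (fun M : 'rV[R]_n => M 0 i) (fun t : R => t ^+ 2)).
    exact: coord_continuous.
  exact: exprn_continuous.
move=> x; exact: (cvgD (cvg_cst s0) (cvgM (cvg_cst (A / 2)) (sq x))).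
Qed.

Section Radial.
Variables (R : realType) (n : nat) (psi p q : R -> R) (s0 A : R).
Hypotheses (A_ge0 : 0 <= A)
  (psi_derive : forall s : R, s0 <= s -> is_derive s 1 psi (p s))
  (p_derive : forall s : R, s0 <= s -> is_derive s 1 p (q s))
  (q_cont : forall s : R, s0 <= s -> {for s, continuous q}).

Definition radial (x : 'rV[R]_n) : R := psi (quad s0 A x).

Lemma le_quad (x : 'rV[R]_n) : s0 <= quad s0 A x.
Proof. by rewrite lerDl mulr_ge0 ?dot_ge0// divr_ge0. Qed.

Lemma radial_derive (x w : 'rV[R]_n) :
  is_derive x w radial (p (quad s0 A x) * (A * (x *m w^T) 0 0)).
Proof. exact: (is_derive_radial w (psi_derive (le_quad x))). Qed.

Lemma radial_partial i :
  partial_d i radial = (fun x => p (quad s0 A x) * (A * (x *m (delta_mx 0 i : 'rV[R]_n)^T) 0 0)).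
Proof.
apply/funext => x; have h := radial_derive x (delta_mx 0 i).
exact: (@derive_val _ _ _ _ _ _ _ h).
Qed.

Lemma radial_partial_derive i (x w : 'rV[R]_n) :
  is_derive x w (partial_d i radial) (A * p (quad s0 A x) * (w *m (delta_mx 0 i : 'rV[R]_n)^T) 0 0
      + A ^+ 2 * q (quad s0 A x) * ((x *m w^T) 0 0 * (x *m (delta_mx 0 i : 'rV[R]_n)^T) 0 0)).
Proof. by rewrite radial_partial; exact: (is_derive2_radial w _ (p_derive (le_quad x))). Qed.

Lemma radial_partial2 i j :
  partial_d j (partial_d i radial) = (fun x =>
    A * p (quad s0 A x) * (i == j)%:R + A ^+ 2 * q (quad s0 A x) * (x 0 j * x 0 i)).
Proof.
apply/funext => x; have h := radial_partial_derive i x (delta_mx 0 j).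
rewrite {1}/partial_d (@derive_val _ _ _ _ _ _ _ h) !dot_delta.
by rewrite mxE eqxx/= eq_sym.
Qed.

Let comp_quad (g : R -> R) : (forall s : R, s0 <= s -> {for s, continuous g}) ->
  continuous (fun x : 'rV[R]_n => g (quad s0 A x)).
Proof.
move=> gc x; apply: (@continuous_comp _ _ _ (quad s0 A) g); first exact: quad_continuous.
exact/gc/le_quad.
Qed.

Lemma radial_C2 : C2 radial.
Proof.
have pc : continuous (fun x : 'rV[R]_n => p (quad s0 A x)).
  by apply: comp_quad => s /p_derive; exact: is_derive1_continuous.
split.
- by apply: comp_quad => s /psi_derive; exact: is_derive1_continuous.
- by move=> i x; have h := radial_derive x (delta_mx 0 i); exact: ex_derive.
- move=> i; rewrite radial_partial.
  rewrite (_ : (fun _ => _) = fun x : 'rV[R]_n => p (quad s0 A x) * (A * x 0 i)); last first.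
    by apply/funext => y; rewrite dot_delta.
  move=> x; exact: (cvgM (pc x) (cvgM (cvg_cst A) (@coord_continuous _ _ _ 0 i x))).
- by move=> i j x; have h := radial_partial_derive i x (delta_mx 0 j); exact: ex_derive.
- move=> i j; rewrite radial_partial2 => x.
  have qc := comp_quad q_cont.
  have c1 : (fun y : 'rV[R]_n => A * p (quad s0 A y) * (i == j)%:R) y @[y --> x] -->
      A * p (quad s0 A x) * (i == j)%:R.
    exact: (cvgM (cvgM (cvg_cst A) (pc x)) (cvg_cst _)).
  have c2 : (fun y : 'rV[R]_n => A ^+ 2 * q (quad s0 A y) * (y 0 j * y 0 i)) y @[y --> x] -->
      A ^+ 2 * q (quad s0 A x) * (x 0 j * x 0 i).
    apply: (cvgM (cvgM (cvg_cst (A ^+ 2)) (qc x))).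
    exact: (cvgM (@coord_continuous R 1 n 0 j x) (@coord_continuous R 1 n 0 i x)).
  exact: (cvgD c1 c2).
Qed.

Lemma radial_hess x : hess radial x =
  (A * p (quad s0 A x))%:M + (A ^+ 2 * q (quad s0 A x)) *: (x^T *m x).
Proof.
apply/matrixP => i j; rewrite mxE radial_partial2 !mxE big_ord1 !mxE.
by rewrite mulr_natr eq_sym.
Qed.

Lemma radial_hess_mu mu x : 0 <= p (quad s0 A x) -> hess_mu mu radial x =
  (A * p (quad s0 A x) * (1 + mu * enorm x))%:M
    + (A ^+ 2 * q (quad s0 A x)) *: (x^T *m x).
Proof.
move=> p0; rewrite /hess_mu radial_hess addrAC -raddfD/=.
have -> : grad radial x = (A * p (quad s0 A x)) *: x.
  apply/matrixP => i j; rewrite ord1 !mxE radial_partial dot_delta.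
  by rewrite mulrA [X in X * _]mulrC.
rewrite enorm_scale ?mulr_ge0//; congr (_%:M + _); ring.
Qed.

End Radial.

Lemma le_powR_inv (R : realType) (k : nat) (a S : R) : (0 < k)%N -> 0 <= a ->
  a ^+ k <= S -> a <= S `^ k%:R^-1.
Proof.
move=> k0 a0 aS; have ak : (a ^+ k) `^ k%:R^-1 = a.
  by rewrite -powR_mulrn// -powRrM mulfV ?powRr1// pnatr_eq0 -lt0n.
rewrite -{1}ak; apply: ge0_ler_powR => //; rewrite ?nnegrE ?exprn_ge0//.
exact: le_trans (exprn_ge0 _ a0) aS.
Qed.

Lemma powR_inv_le (R : realType) (k : nat) (a S : R) : (0 < k)%N -> 0 <= a -> 0 <= S ->
  a <= S `^ k%:R^-1 -> a ^+ k <= S.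
Proof.
move=> k0 a0 S0 aS; rewrite (_ : S = (S `^ k%:R^-1) ^+ k).
  by rewrite lerXn2r ?nnegrE ?powR_ge0.
by rewrite -powR_mulrn ?powR_ge0// -powRrM mulVf ?powRr1// pnatr_eq0 -lt0n.
Qed.

(** * Scalar inequalities for the radial sub- and supersolutions *)

Section Inequalities.
Variable R : realFieldType.

(** Here p = psi', d = G'(psi), g = f(psi), r2 = |x|^2, and gT is the value of g at s0 + 1. Where
    A^(k+2) r2 >= k+2 the rank-one part alone suffices. Elsewhere A >= k+2 forces A r2 <= 1, so g <=
    gT <= A a <= A p, and the scalar part suffices. *)
Lemma subsolution_ineq (k : nat) (A a p g gT r2 d al : R) :
  k.+2%:R <= A -> 0 < a -> a <= p -> 0 <= r2 -> 0 <= d -> 0 < g -> gT <= A * a ->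
  A * p <= al ->
  g ^+ k.+1 <= k.+2%:R * (d * p ^+ k.+1) ->
  (A / 2 * r2 <= 1 -> g <= gT) ->
  g ^+ k.+1 <= al ^+ k * (al + A ^+ 2 * (d * p) * r2).
Proof.
move=> kA a0 ap r20 d0 g0 gTA Apal gd small.
have A1 : 1 <= A by apply: le_trans kA; rewrite ler1n.
have A0 : 0 < A by lra.
have p0 : 0 < p by lra.
have Ap0 : 0 <= A * p by rewrite mulr_ge0 ?ltW.
have al0 : 0 <= al by lra.
have q0 : 0 <= A ^+ 2 * (d * p) * r2.
  by rewrite !mulr_ge0 ?exprn_ge0// ltW.
have low : (A * p) ^+ k * (A * p + A ^+ 2 * (d * p) * r2) <=
    al ^+ k * (al + A ^+ 2 * (d * p) * r2).
  apply: ler_pM; rewrite ?exprn_ge0 ?addr_ge0//; first by rewrite lerXn2r ?nnegrE.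
  by rewrite lerD2r.
apply: le_trans low; have [big|/ltW sm] := leP k.+2%:R (A ^+ k.+2 * r2).
  apply: (le_trans gd); apply: (@le_trans _ _ (A ^+ k.+2 * r2 * (d * p ^+ k.+1))).
    by rewrite ler_wpM2r// mulr_ge0// exprn_ge0// ltW.
  rewrite mulrDr (_ : A ^+ k.+2 * r2 * (d * p ^+ k.+1) =
    (A * p) ^+ k * (A ^+ 2 * (d * p) * r2)).
    by rewrite lerDr mulr_ge0// exprn_ge0.
  by rewrite exprMn !exprS expr0; ring.
have gle : g <= A * p.
  apply: (le_trans (small _)); last first.
    by apply: (le_trans gTA); rewrite ler_pM2l.
  have : A * r2 * A <= A.
    apply: (@le_trans _ _ k.+2%:R) => //; apply: le_trans sm.
    rewrite (_ : A * r2 * A = A ^+ 2 * r2); last by ring.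
    by rewrite ler_wpM2r// -[k.+2]addn2 exprD ler_peMl ?exprn_ge0 ?exprn_ege1// ltW.
  rewrite -[leRHS]mul1r ler_pM2r// => h; lra.
apply: (@le_trans _ _ ((A * p) ^+ k.+1)); first by rewrite lerXn2r ?nnegrE ?(ltW g0).
by rewrite exprSr ler_wpM2l ?exprn_ge0 ?lerDl.
Qed.

(** The trace case, where mu may be negative. If A r >= m, the d part of the last term exceeds g,
    and its remaining part A^2 p r^2 absorbs the gradient term because A r >= N |mu|; the 1 in d + 1
    is the derivative of the summand u in G. If A r < m, then A r^2 <= 1 and |mu| r <= 1/2, so half
    of A p is left and 2 gT <= A a concludes. *)
Lemma subsolution_ineq_laplacian (N A a p g gT r d mu m W : R) :
  1 <= N -> m = 2 + 2 * N * `|mu| -> m ^+ 2 <= A -> 0 < a -> a <= p -> 0 <= r -> 0 <= d ->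
  0 < g -> 2 * gT <= A * a -> 0 <= W -> W <= p -> g <= 2 * (d * W) ->
  (A / 2 * r ^+ 2 <= 1 -> g <= gT) ->
  g <= N * (A * p * (1 + mu * r)) + A ^+ 2 * ((d + 1) * p) * r ^+ 2.
Proof.
move=> N1 mE mA a0 ap r0 d0 g0 gTA W0 Wp gd small.
have mu0 : 0 <= `|mu| by [].
have muN : - `|mu| <= mu by rewrite lerNl -normrN ler_norm.
have Nmu : 0 <= N * `|mu| by rewrite mulr_ge0//; lra.
have m2 : 2 <= m by rewrite mE; lra.
have m4 : 4 <= m ^+ 2 by nra.
have A0 : 0 < A by lra.
have p0 : 0 < p by lra.
have Ap0 : 0 < A * p by rewrite mulr_gt0.
have Ar0 : 0 <= A * r by rewrite mulr_ge0 ?(ltW A0).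
have mur : - (`|mu| * r) <= mu * r by rewrite -mulNr ler_wpM2r.
have dp : g <= 2 * (d * p).
  by apply: (le_trans gd); rewrite ler_pM2l ?ltr0n// ler_wpM2l.
have [big|sm] := leP m (A * r).
  have q4 : 4 <= (A * r) ^+ 2 by apply: (le_trans m4); rewrite lerXn2r ?nnegrE//; lra.
  have t1 : g <= (A * r) ^+ 2 * (d * p).
    have : 0 <= d * p by rewrite mulr_ge0 ?(ltW p0).
    by nra.
  have t2 : 0 <= p * (A * r) * (A * r - N * `|mu|).
    by rewrite !mulr_ge0 ?(ltW p0)//; move: big; rewrite mE; lra.
  have t3 : N * (A * p * - (`|mu| * r)) <= N * (A * p * (mu * r)).
    by rewrite ler_wpM2l ?ler_pM2l//; lra.
  have t4 : 0 <= N * (A * p) by rewrite mulr_ge0 ?(ltW Ap0)//; lra.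
  by lra.
have Arm : A * r * A <= m * A by rewrite ler_wpM2r ?(ltW A0) ?(ltW sm).
have Ar2 : A * (A * r ^+ 2) <= A * 1.
  rewrite (_ : A * (A * r ^+ 2) = (A * r) ^+ 2); last by ring.
  by rewrite mulr1; apply: le_trans mA; rewrite lerXn2r ?nnegrE ?(ltW sm)//; lra.
have r2 : A * r ^+ 2 <= 1 by move: Ar2; rewrite ler_pM2l.
have mur2 : `|mu| * r <= 1 / 2.
  have : A * (`|mu| * r) <= A * (1 / 2).
    have mum : `|mu| <= m / 2.
      have : `|mu| <= N * `|mu| by rewrite ler_peMl.
      by rewrite mE; lra.
    have : `|mu| * (A * r) <= m / 2 * m.
      by apply: ler_pM => //; exact: ltW.
    by lra.
  by rewrite ler_pM2l.
have gT' : g <= gT by apply: small; lra.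
have h1 : A * p * (1 / 2) <= A * p * (1 + mu * r) by rewrite ler_pM2l//; lra.
have h2 : A * a <= A * p by rewrite ler_pM2l.
have h3 : A * p * (1 + mu * r) <= N * (A * p * (1 + mu * r)).
  by rewrite ler_peMl//; lra.
have h4 : 0 <= A ^+ 2 * ((d + 1) * p) * r ^+ 2.
  by rewrite !mulr_ge0 ?exprn_ge0 ?(ltW p0)// ?(ltW A0)// addr_ge0.
by lra.
Qed.

(* With the scale [A = e ^+ 2], both [A] and [A * r] are of order [e] on the ball
   [A / 2 * r ^+ 2 <= M]. *)
Lemma supersolution_ineq (k : nat) (C C1 M mu e p g r d : R) :
  0 <= C -> 0 <= C1 -> 0 <= M -> 0 <= mu -> 0 < e ->
  e * (2 * (1 + mu * (2 * M + 1)) * (1 + C * (C1 + 2 * M))) = 1 ->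
  0 <= r -> e ^+ 2 / 2 * r ^+ 2 <= M -> 0 <= p -> 0 <= d -> 0 < g ->
  p ^+ k.+1 <= C1 * g ^+ k.+1 -> d * p ^+ k.+1 <= g ^+ k.+1 ->
  C * ((e ^+ 2 * p * (1 + mu * r)) ^+ k *
     (e ^+ 2 * p * (1 + mu * r) + (e ^+ 2) ^+ 2 * (d * p) * r ^+ 2)) < g ^+ k.+1.
Proof.
move=> C0 C10 M0 mu0 e0 eE r0 rM p0 d0 g0 pg dg.
set Y := 1 + mu * (2 * M + 1) in eE; set Z := 1 + C * (C1 + 2 * M) in eE.
have Y1 : 1 <= Y by rewrite lerDl mulr_ge0//; lra.
have CZ : 0 <= C * (C1 + 2 * M) by rewrite mulr_ge0//; lra.
have Z1 : 1 <= Z by rewrite lerDl.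
have e1 : e <= 1.
  have : 1 <= 2 * Y * Z by nra.
  by nra.
have er0 : 0 <= e * r by rewrite mulr_ge0 ?(ltW e0).
have er : e * r <= 2 * M + 1.
  have : (e * r) ^+ 2 <= (2 * M + 1) ^+ 2.
    by rewrite (_ : (e * r) ^+ 2 = e ^+ 2 * r ^+ 2); [nra|ring].
  by rewrite ler_pXn2r ?nnegrE//; lra.
(* alpha = y p. From e <= 1 and e r <= 2 M + 1 one gets y <= e Y, so the normalization of e yields 2
   y Z <= 1, which beats the constant C (C1 + 2 M) < Z. *)
pose y := e ^+ 2 * (1 + mu * r).
have mur : 0 <= mu * r by rewrite mulr_ge0.
have y0 : 0 <= y by rewrite mulr_ge0 ?exprn_ge0 ?(ltW e0)//; lra.
have yY : y <= e * Y.
  rewrite (_ : y = e * (e + mu * (e * r))); last by rewrite /y; ring.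
  by rewrite ler_pM2l// lerD// ler_wpM2l.
have yZ : y * (2 * Z) <= 1.
  apply: (@le_trans _ _ (e * Y * (2 * Z))); first by apply: ler_wpM2r => //; lra.
  have -> : e * Y * (2 * Z) = e * (2 * Y * Z) by ring.
  by rewrite eE.
have y1 : y <= 1 by nra.
have ypk : y ^+ k.+1 <= y by rewrite exprSr ler_piMl// exprn_ile1.
have gk : 0 < g ^+ k.+1 by exact: exprn_gt0.
have pk0 : 0 <= p ^+ k.+1 by exact: exprn_ge0.
apply: (@le_lt_trans _ _ (C * (y ^+ k.+1 * ((C1 + 2 * M) * g ^+ k.+1)))); last first.
  apply: (@le_lt_trans _ _ (C * (y * ((C1 + 2 * M) * g ^+ k.+1)))).
    by rewrite ler_wpM2l// ler_wpM2r// mulr_ge0 ?(ltW gk)//; lra.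
  rewrite (_ : C * _ = y * (C * (C1 + 2 * M)) * g ^+ k.+1); last by ring.
  rewrite -[ltRHS]mul1r ltr_pM2r//.
  have : y * (C * (C1 + 2 * M)) <= y * Z by rewrite ler_wpM2l// lerDr.
  by nra.
rewrite ler_wpM2l//.
have -> : e ^+ 2 * p * (1 + mu * r) = y * p by rewrite /y; ring.
have yk : 0 <= y ^+ k by rewrite exprn_ge0.
have h1 : (e ^+ 2) ^+ 2 * (d * p) * r ^+ 2 <= y * (d * p) * (2 * M).
  have e2y : e ^+ 2 <= y by rewrite /y ler_peMr ?exprn_ge0 ?(ltW e0)//; lra.
  rewrite (_ : _ * r ^+ 2 = e ^+ 2 * (d * p) * (e ^+ 2 * r ^+ 2)); last by ring.
  apply: ler_pM; rewrite ?mulr_ge0 ?exprn_ge0 ?(ltW e0)//; last by lra.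
  by rewrite ler_wpM2r// mulr_ge0.
apply: (@le_trans _ _ ((y * p) ^+ k * (y * p + y * (d * p) * (2 * M)))).
  apply: ler_wpM2l; first by apply: exprn_ge0; exact: mulr_ge0.
  by rewrite lerD2l.
rewrite (_ : _ * _ = y ^+ k.+1 * (p ^+ k.+1 + d * p ^+ k.+1 * (2 * M))); last first.
  by rewrite exprMn !exprSr; ring.
apply: ler_wpM2l; first exact: exprn_ge0.
rewrite [leRHS]mulrDl; apply: lerD => //; rewrite [leLHS]mulrC.
by apply: ler_wpM2l => //; lra.
Qed.

End Inequalities.

(* [psi] solves [psi' = G psi] with [G u = Wfun 0 u + u]; the term [u] makes
   [psi' >= psi], which absorbs the gradient term when [k = 1]. *)
Lemma entire_profile (R : realType) (k : nat) (f : R -> R) (a : R)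
    (f_cont : continuous f) (f_pos : forall t : R, 0 < f t)
    (f_mono : forall s t : R, s <= t -> f s <= f t) (ha : 0 < a) :
  KO_integral k f a = +oo%E ->
  exists psi : R -> R, exists2 s0 : R, 0 < s0 &
    let p s := Wfun k f 0 (psi s) + psi s in
    forall s : R, s0 <= s -> a < psi s /\ is_derive s 1 psi (p s).
Proof.
move=> KO; pose G u := Wfun k f 0 u + u.
have a20 : 0 < a / 2 by rewrite divr_gt0.
have G0 u : 0 < u -> 0 < G u by move=> u0; rewrite addr_gt0// Wfun_gt0.
have [|u au|K [Ka Kd]] := @exists_primitive R (fun u => (G u)^-1) (a / 2) a; first by lra.
  have u0 := lt_trans a20 au.
  apply: continuousV; first exact: lt0r_neq0 (G0 u u0).
  apply: cvgD; last exact: cvg_id.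
  exact: (Wfun_continuous f_cont f_pos u0).
have Kinf := KO_divergence f_cont f_pos ha Kd KO.
have G0' u : a <= u -> 0 < G u by move=> au; apply: G0; exact: lt_le_trans au.
have aa1 : a < a + 1 by rewrite ltrDl.
have Ka1 : 0 < K (a + 1) by rewrite -Ka; exact: (flow_lt G0' Kd (lexx a) aa1).
(* Starting at K (a + 1) instead of K a = 0 keeps every s >= s0 strictly inside the range of K, as
   [flow_spec] requires. *)
exists (flow K a), (K (a + 1)) => //= s s0s.
have [u au su] := Kinf s.
have [|c1 _ _ d1] := flow_spec G0' Kd _ au su; first by rewrite Ka; exact: lt_le_trans s0s.
by split.
Qed.

(** * Existence of an entire subsolution *)

Lemma existence (R : realType) (n k : nat) (mu : R) (f : R -> R) (a : R)
    (hk : (k <= n)%N)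
    (f_cont : continuous f) (f_pos : forall t : R, 0 < f t)
    (f_mono : forall s t : R, s <= t -> f s <= f t)
    (ha : 0 < a) :
  k = 0%N \/ 0 <= mu ->
  KO_integral k.+1 f a = +oo%E ->
  exists u : 'rV[R]_n.+1 -> R, is_subsolution k.+1 mu f u.
Proof.
move=> kmu KO; have [psi [s0 s00 psiP]] := entire_profile f_cont f_pos f_mono ha KO.
pose W := Wfun k.+1 f 0; pose dW := dWfun k.+1 f 0.
pose p s := W (psi s) + psi s; pose q s := (dW (psi s) + 1) * p s.
have psia s : s0 <= s -> a < psi s by move=> /psiP[].
have psi0 s : s0 <= s -> 0 < psi s by move=> /psia; exact: lt_trans.
have psid (s : R) : s0 <= s -> is_derive s 1 psi (p s) by move=> /psiP[].
have psic (s : R) : s0 <= s -> {for s, continuous psi}.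
  by move=> /psid; exact: is_derive1_continuous.
have W0 s : s0 <= s -> 0 < W (psi s) by move=> /psi0; exact: Wfun_gt0.
have dW0 s : 0 <= dW (psi s) by exact: dWfun_ge0.
have ap s : s0 <= s -> a <= p s.
  by move=> s0s; apply: ltW; apply: (lt_trans (psia s s0s)); rewrite ltrDr W0.
have p0 s : s0 <= s -> 0 < p s by move=> /ap; exact: lt_le_trans.
have pd (s : R) : s0 <= s -> is_derive s 1 p (q s).
  move=> s0s; have h := is_derive1_comp (Wfun_derive k.+1 f_cont f_pos (psi0 s s0s)) (psid s s0s).
  have hh := is_deriveD h (psid s s0s); apply: (is_derive_eq hh).
  by rewrite /q mulrDl mul1r.
have qc (s : R) : s0 <= s -> {for s, continuous q}.
  move=> s0s.
  have h1 : dW (psi t) @[t --> s] --> dW (psi s).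
    have h0 := dWfun_continuous f_cont f_pos (psi0 s s0s).
    exact: (@continuous_comp _ _ _ psi dW s (psic s s0s) (h0 k.+1)).
  have h2 : p t @[t --> s] --> p s by exact: (is_derive1_continuous (pd s s0s)).
  have h3 : (dW (psi t) + 1) @[t --> s] --> dW (psi s) + 1 by exact: (cvgD h1 (cvg_cst _)).
  exact: (cvgM h3 h2).
have psimono s t : s0 <= s -> s <= t -> psi s <= psi t.
  move=> s0s st; rewrite -subr_ge0.
  have [|r /andP[sr _] ->] := @mvt_cc R psi p s t st.
    by move=> r /andP[sr _]; apply: psid; exact: le_trans sr.
  by rewrite mulr_ge0 ?subr_ge0// ltW// p0// (le_trans s0s).
pose gT := f (psi (s0 + 1)).
have gT0 : 0 < gT := f_pos _.
pose m := 2 + 2 * n.+1%:R * `|mu| : R.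
(* Each summand meets one lower bound on A required by the two inequalities; the order of the
   operator is k+1, whence k+2. *)
pose A := k.+2%:R + m ^+ 2 + 2 * gT / a : R.
have k20 : 0 <= k.+2%:R :> R by [].
have m20 : 0 <= m ^+ 2 by rewrite sqr_ge0.
have ga0 : 0 <= 2 * gT / a by rewrite divr_ge0 ?ltW// mulr_gt0.
have kA : k.+2%:R <= A by rewrite /A; lra.
have mA : m ^+ 2 <= A by rewrite /A; lra.
have A1 : 1 <= A by apply: le_trans kA; rewrite ler1n.
have A0 : 0 < A by lra.
have gA : 2 * gT <= A * a.
  have -> : 2 * gT = 2 * gT / a * a by rewrite divfK// gt_eqF.
  by rewrite ler_pM2r// /A; lra.
exists (radial psi s0 A).
have A0' := ltW A0.
have hm x := radial_hess_mu A0' psid pd mu (ltW (p0 _ (le_quad s0 A0' x))).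
set al := fun x : 'rV[R]_n.+1 => A * p (quad s0 A x) * (1 + mu * enorm x).
set be := fun x : 'rV[R]_n.+1 => A ^+ 2 * q (quad s0 A x).
have be0 x : 0 <= be x.
  have sx := le_quad s0 A0' x.
  rewrite /be /q; apply: mulr_ge0; first by rewrite exprn_ge0.
  by apply: mulr_ge0; [rewrite addr_ge0 ?dW0|exact: ltW (p0 _ sx)].
have en0 (x : 'rV[R]_n.+1) : 0 <= enorm x by rewrite sqrtr_ge0.
have fsmall (x : 'rV[R]_n.+1) : A / 2 * enorm x ^+ 2 <= 1 -> f (psi (quad s0 A x)) <= gT.
  rewrite enorm_sqr => h; apply: f_mono; apply: psimono; first exact: le_quad.
  by rewrite lerD2l.
have dWW (x : 'rV[R]_n.+1) : f (psi (quad s0 A x)) ^+ k.+1 =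
    k.+2%:R * (dW (psi (quad s0 A x)) * W (psi (quad s0 A x)) ^+ k.+1).
  have := dWfun_pow k.+1 f_cont f_pos (psi0 _ (le_quad s0 A0' x)).
  rewrite -/dW -/W => ->; rewrite mulrC divfK// pnatr_eq0.
suff key (x : 'rV[R]_n.+1) : (forall j, (0 < j <= k.+1)%N ->
      0 < elem_sym j (eigvals (hess_mu mu (radial psi s0 A) x))) /\
    f (psi (quad s0 A x)) ^+ k.+1 <= Sk k.+1 (hess_mu mu (radial psi s0 A) x).
  split; first split.
  - exact: (radial_C2 _ A0' psid pd qc).
  - by move=> x; have [] := key x.
  - move=> x; apply: le_powR_inv => //; first exact: ltW.
    by have [] := key x.
rewrite hm -/(al x) -/(be x).
have sx := le_quad s0 A0' x.
set s := quad s0 A x in sx *.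
(* For negative mu alpha may be negative, but then the order is 1 and only the trace has to be
   controlled. *)
have [muneg|mu0] := ltP mu 0.
  have k0 : k = 0%N by case: kmu => // h; move: muneg; rewrite ltNge h.
  rewrite k0 in dWW *.
  have S1 : f (psi s) <= elem_sym 1 (eigvals ((al x)%:M + be x *: (x^T *m x))).
    rewrite elem_sym_rank1_trace -enorm_sqr /al /be /q -/s.
    apply: (@subsolution_ineq_laplacian _ _ A a (p s) _ gT (enorm x) (dW (psi s)) mu m
      (W (psi s))) => //.
    - by rewrite ler1n.
    - exact: ap.
    - by rewrite ltW// W0.
    - by rewrite lerDl ltW// psi0.
    - by have := dWW x; rewrite -/s !expr1 => ->.
    - exact: fsmall.
  split; last by rewrite expr1.
  move=> [|[|j]]// _; exact: lt_le_trans (f_pos _) S1.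
have ga : 0 < al x by rewrite /al !mulr_gt0 ?p0// ltr_pwDl// mulr_ge0.
have ge j : (j <= k)%N -> 0 < elem_sym j.+1 (eigvals ((al x)%:M + be x *: (x^T *m x))).
  move=> jk; apply: (lt_le_trans _ (elem_sym_rank1_ge x (ltW ga) (be0 x) (leq_trans jk hk))).
  by rewrite mulr_gt0 ?exprn_gt0// ltr_pwDl// mulr_ge0// dot_ge0.
split; first by case=> // j; exact: ge.
apply: (le_trans _ (elem_sym_rank1_ge x (ltW ga) (be0 x) hk)).
rewrite -enorm_sqr /be /q -/s.
apply: (@subsolution_ineq _ k A a (p s) _ gT (enorm x ^+ 2) (dW (psi s) + 1)) => //.
- exact: ap.
- by rewrite exprn_ge0.
- by rewrite addr_ge0.
- by lra.
- by rewrite /al -/s ler_peMr ?mulr_ge0 ?(ltW (p0 s sx))// lerDl mulr_ge0.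
- rewrite (dWW x) -/s ler_wpM2l// ler_pM ?exprn_ge0 ?dW0 ?(ltW (W0 s sx))//.
    by rewrite lerDl.
  by rewrite lerXn2r ?nnegrE ?(ltW (W0 s sx)) ?(ltW (p0 s sx))// lerDl ltW// psi0.
- exact: fsmall.
Qed.

(** * Nonexistence by comparison with an exploding radial function *)

Lemma row_normr_le_enorm (R : realType) n (x : 'rV[R]_n) : `|x| <= enorm x.
Proof.
rewrite [leLHS]mx_normrE; apply: bigmax_le => [|[i j] _ /=]; first exact: sqrtr_ge0.
rewrite ord1 -sqrtr_sqr ler_sqrt ?sumr_ge0// => [|k _]; last exact: sqr_ge0.
by rewrite (bigD1 j)//= lerDl sumr_ge0// => k _; exact: sqr_ge0.
Qed.

Lemma quad_sublevel_compact (R : realType) n (s0 s1 A : R) : 0 < A ->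
  compact [set x : 'rV[R]_n | quad s0 A x <= s1].
Proof.
move=> A0; apply: bounded_closed_compact; last first.
  apply: (@closed_comp _ _ (quad s0 A) [set y | y <= s1]); last exact: closed_le.
  by move=> x _; exact: quad_continuous.
(* A bound c on |x|^2 gives |x| <= 1 + c, without a square root. *)
exists (1 + 2 * (s1 - s0) / A); split; first exact: num_real.
move=> M hM x /= xs; apply: le_trans (row_normr_le_enorm x) _; apply: le_trans (ltW hM).
have e0 : 0 <= enorm x by exact: sqrtr_ge0.
have : enorm x ^+ 2 <= 2 * (s1 - s0) / A.
  rewrite ler_pdivlMr// enorm_sqr; move: xs; rewrite /quad; lra.
by nra.
Qed.

Section Touching.
Variables (R : realType) (n : nat) (u : 'rV[R]_n -> R) (psi p q : R -> R) (s0 s1 A : R).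
Hypotheses (u_C2 : C2 u) (A_ge0 : 0 <= A)
  (psi_derive : forall s : R, s0 <= s <= s1 -> is_derive s 1 psi (p s))
  (p_derive : forall s : R, s0 <= s <= s1 -> is_derive s 1 p (q s)).

(** First and second derivative tests along the line through x0 in direction w. The strict
    inequality keeps a segment of that line inside the ball on which psi is differentiable. *)
Lemma touching (x0 w : 'rV[R]_n) : quad s0 A x0 < s1 ->
  (forall x, quad s0 A x <= s1 ->
     u x - psi (quad s0 A x) <= u x0 - psi (quad s0 A x0)) ->
  \sum_i w 0 i * partial_d i u x0 = A * p (quad s0 A x0) * (x0 *m w^T) 0 0 /\
  (w *m hess u x0 *m w^T) 0 0 <= A * p (quad s0 A x0) * (w *m w^T) 0 0
    + A ^+ 2 * q (quad s0 A x0) * (x0 *m w^T) 0 0 ^+ 2.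
Proof.
move=> xs xmax; have [u1 u2] := C2_second_derivative x0 w u_C2.
have lq x : s0 <= quad s0 A x by exact: le_quad.
pose l (t : R) := x0 + t *: w.
have l0 : l 0 = x0 by rewrite /l scale0r addr0.
have [d d0 ld] : exists2 d, 0 < d & forall t, - d < t < d -> quad s0 A (l t) < s1.
  have /is_derive_lineP h : is_derive (x0 + (0 : R) *: w) w (quad s0 A)
     (A * ((x0 + (0 : R) *: w) *m w^T) 0 0) by exact: is_derive_quad.
  have := is_derive1_continuous h; rewrite /prop_for /continuous_at /= -/(l 0) l0.
  move/cvgrPdist_lt => /(_ (s1 - quad s0 A x0)); rewrite subr_gt0 => /(_ xs).
  move=> /nbhs_ballP[d /= d0 hd]; exists d => // t /andP[t1 t2].
  have := hd t; rewrite /ball/= sub0r normrN ltr_norml t1 t2 => /(_ isT).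
  by rewrite ltr_norml => /andP[h1 _]; move: h1; rewrite /l; lra.
pose f t := u (l t) - psi (quad s0 A (l t)).
pose df t := \sum_i w 0 i * partial_d i u (l t)
   - p (quad s0 A (l t)) * (A * (l t *m w^T) 0 0).
pose c := (w *m hess u x0 *m w^T) 0 0 - (A * p (quad s0 A x0) * (w *m w^T) 0 0
  + A ^+ 2 * q (quad s0 A x0) * ((x0 *m w^T) 0 0 * (x0 *m w^T) 0 0)).
have fd t : - d < t < d -> is_derive t 1 f (df t).
  move=> td; have lt_ : s0 <= quad s0 A (l t) <= s1 by rewrite lq ltW// ld.
  have /is_derive_lineP h2 : is_derive (x0 + t *: w) w (psi \o quad s0 A)
     (p (quad s0 A (l t)) * (A * (l t *m w^T) 0 0)).
    exact: (is_derive_radial w (psi_derive lt_)).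
  exact: (is_deriveB (u1 t) h2).
have dfd : is_derive (0 : R) 1 df c.
  have x0s : s0 <= quad s0 A x0 <= s1 by rewrite lq ltW.
  have h := is_derive2_radial w w (p_derive x0s).
  have : is_derive (x0 + (0 : R) *: w) w
    (fun y => p (quad s0 A y) * (A * (y *m w^T) 0 0))
    (A * p (quad s0 A x0) * (w *m w^T) 0 0
      + A ^+ 2 * q (quad s0 A x0) * ((x0 *m w^T) 0 0 * (x0 *m w^T) 0 0)).
    by rewrite scale0r addr0.
  move=> /is_derive_lineP h2.
  exact: (is_deriveB u2 h2).
have fm t : - d < t < d -> f t <= f 0.
  by move=> td; rewrite /f l0; apply: xmax; rewrite ltW// ld.
have [df0 c0] := second_derivative_test d0 fd dfd fm.
split.
  by move/eqP: df0; rewrite /df l0 subr_eq0 => /eqP ->; rewrite mulrCA mulrA.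
by rewrite expr2 -subr_le0.
Qed.

End Touching.

Lemma nonexistence (R : realType) (n k : nat) (mu : R) (f : R -> R) (a : R)
    (f_cont : continuous f) (f_pos : forall t : R, 0 < f t)
    (f_mono : forall s t : R, s <= t -> f s <= f t)
    (ha : 0 < a) :
  (KO_integral k.+1 f a < +oo)%E ->
  ~ exists u : 'rV[R]_n.+1 -> R, is_subsolution k.+1 mu f u.
Proof.
move=> KO [u [[uC2 uG] usub]].
(* This leaves room for b < c1 < c2 < u(0) and gives b <= 0, needed in [KO_convergence]. The profile
   starts at c2, strictly inside the flow, so it lies below u at the origin. *)
pose b := Num.min (u 0) 0 - 2.
have mu0 : Num.min (u 0) 0 <= u 0 by exact: ge_min_l.
have m00 : Num.min (u 0) 0 <= 0 by exact: ge_min_r.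
have b0 : b <= 0 by rewrite /b; lra.
pose c1 := b + 1; have bc : b < c1 by rewrite ltrDl.
pose W := Wfun k.+1 f b; pose dW := dWfun k.+1 f b.
have W0 (v : R) : b < v -> 0 < W v by exact: Wfun_gt0.
have [v bv|K [Kc Kd]] := @exists_primitive R (fun v => (W v)^-1) b c1 bc.
  apply: continuousV; first exact: lt0r_neq0 (W0 v bv).
  exact: (Wfun_continuous f_cont f_pos bv).
have [M KM] := KO_convergence f_cont f_pos ha b0 bc Kd KO.
have [C1 C10 WC] := Wfun_le_f f_cont f_pos f_mono bc Kd KM.
have W0' (v : R) : c1 <= v -> 0 < W v by move=> cv; apply: W0; exact: lt_le_trans cv.
have Klt := flow_lt W0' Kd.
pose c2 := c1 + 2^-1; have c12 : c1 < c2 by rewrite ltrDl invr_gt0.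
have c2u : c2 < u 0 by rewrite /c2 /c1 /b; lra.
pose s0 := K c2; have s00 : 0 < s0 by rewrite /s0 -Kc; exact: Klt.
have M0 : 0 < M by apply: lt_le_trans s00 _; apply: KM; exact: ltW.
pose psi := flow K c1; pose p s := W (psi s); pose q s := dW (psi s) * p s.
have psis0 : psi s0 = c2 by apply: (flowK W0' Kd); exact: ltW.
have flowP s U : s0 <= s -> c1 <= U -> s <= K U ->
    [/\ c1 < psi s, is_derive s 1 psi (p s) & is_derive s 1 p (q s)].
  move=> s0s cU sU; have sU1 : s < K (U + 1).
    by apply: (le_lt_trans sU); apply: Klt => //; rewrite ltrDl.
  have cU1 : c1 <= U + 1 by apply: (le_trans cU); rewrite lerDl.
  have [|h1 _ _ h2] := flow_spec W0' Kd _ cU1 sU1.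
    by rewrite Kc; exact: lt_le_trans s0s.
  have h3 := Wfun_derive k.+1 f_cont f_pos (lt_trans bc h1).
  by split => //; exact: (is_derive1_comp h3 h2).
(* With |mu| in place of mu the bound on the form only grows, and alpha is nonnegative for either
   sign of mu. *)
pose m := `|mu|; pose C := 'C(n.+1, k.+1)%:R : R.
have m0 : 0 <= m by exact: normr_ge0.
have C0 : 0 <= C by exact: ler0n.
pose Z := 2 * (1 + m * (2 * M + 1)) * (1 + C * (C1 + 2 * M)).
have Z0 : 0 < Z.
  have h1 : 0 <= m * (2 * M + 1) by rewrite mulr_ge0//; lra.
  have h2 : 0 <= C * (C1 + 2 * M) by rewrite mulr_ge0//; lra.
  by rewrite /Z !mulr_gt0//; lra.
pose e := Z^-1; have e0 : 0 < e by rewrite invr_gt0.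
have eE : e * Z = 1 by rewrite mulVf// gt_eqF.
pose A := e ^+ 2; have A0 : 0 < A by rewrite exprn_gt0.
have q0 : quad s0 A (0 : 'rV[R]_n.+1) = s0 by rewrite /quad mul0mx mxE mulr0 addr0.
have uc : continuous u by case: uC2.
(* The maximum of u is taken over a ball fixed in advance. The level U above it determines s1 = K U
   <= M, so the ball up to s1 is contained in this one and no circularity arises. *)
have [y _ ymax] : exists2 y : 'rV[R]_n.+1, y \in [set x | quad s0 A x <= M] &
    forall t, t \in [set x | quad s0 A x <= M] -> u t <= u y.
  apply: EVT_max_rV; first by exists 0; rewrite /= q0 KM// ltW.
    exact: quad_sublevel_compact.
  exact: continuous_subspaceT.
pose U := Num.max (u y) c2 + 1.
have Uy : u y < U by rewrite /U ltr_pwDr// le_max lexx.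
have U2 : c2 < U by rewrite /U ltr_pwDr// le_max lexx orbT.
have U1 : c1 <= U by rewrite ltW// (lt_trans c12).
pose s1 := K U; have s01 : s0 < s1 by apply: Klt => //; exact: ltW.
have s1M : s1 <= M by exact: KM.
have psis1 : psi s1 = U by exact: (flowK W0' Kd).
have lq (x : 'rV[R]_n.+1) : s0 <= quad s0 A x by exact: le_quad (ltW A0) x.
have psid (s : R) : s0 <= s <= s1 -> is_derive s 1 psi (p s).
  by move=> /andP[h1 h2]; have [] := flowP s U h1 U1 h2.
have pd (s : R) : s0 <= s <= s1 -> is_derive s 1 p (q s).
  by move=> /andP[h1 h2]; have [] := flowP s U h1 U1 h2.
have [x0 x0in xmax] : exists2 x0 : 'rV[R]_n.+1, x0 \in [set x | quad s0 A x <= s1] &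
    forall t, t \in [set x | quad s0 A x <= s1] ->
      u t - psi (quad s0 A t) <= u x0 - psi (quad s0 A x0).
  apply: EVT_max_rV; first by exists 0; rewrite /= q0 ltW.
    exact: quad_sublevel_compact.
  apply/continuous_in_subspaceT => x; rewrite inE/= => xs.
  have h : psi (quad s0 A t) @[t --> x] --> psi (quad s0 A x).
    apply: (@continuous_comp _ _ _ (quad s0 A) psi); first exact: quad_continuous.
    by apply: (@is_derive1_continuous _ psi _ (p (quad s0 A x))); apply: psid; rewrite lq.
  exact: (cvgB (uc x) h).
have {}xmax x : quad s0 A x <= s1 -> u x - psi (quad s0 A x) <= u x0 - psi (quad s0 A x0).
  by move=> xs; apply: xmax; rewrite inE.
move: x0in; rewrite inE/= => x0s1.
have gap : 0 < u x0 - psi (quad s0 A x0).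
  have h := xmax (0 : 'rV[R]_n.+1); rewrite q0 psis0 in h.
  by apply: lt_le_trans (h (ltW s01)); rewrite subr_gt0.
(* On the sphere of level s1 the profile equals U > u, whereas the maximum of the difference is
   positive because it is so at the origin. *)
have x0s : quad s0 A x0 < s1.
  rewrite lt_neqAle x0s1 andbT; apply/eqP => E.
  have : u x0 <= u y by apply: ymax; rewrite inE/= E.
  by move: gap; rewrite E psis1; lra.
have T w := touching uC2 (ltW A0) psid pd w x0s xmax.
set s := quad s0 A x0 in gap T x0s x0s1.
have [cs _ _] := flowP s U (lq x0) U1 x0s1.
have bs := lt_trans bc cs.
have p0 : 0 < p s by exact: W0.
have Ap0 : 0 <= A * p s by rewrite mulr_ge0// ltW.
have gE : grad u x0 = (A * p s) *: x0.
  apply/matrixP => i j; rewrite ord1 !mxE.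
  have [E _] := T (delta_mx 0 j); rewrite dot_delta in E; rewrite -E.
  rewrite (bigD1 j)//= big1 ?addr0 => [|l lj]; first by rewrite mxE !eqxx mul1r.
  by rewrite mxE (negbTE lj) andbF mul0r.
have dW0 : 0 <= dW (psi s) by exact: dWfun_ge0.
have dWp : dW (psi s) * p s ^+ k.+1 <= f (psi s) ^+ k.+1.
  rewrite (dWfun_pow k.+1 f_cont f_pos bs) ler_pdivrMr// ler_peMr ?ler1n//.
  by rewrite exprn_ge0// ltW.
have r0 : 0 <= enorm x0 by exact: sqrtr_ge0.
have rM : A / 2 * enorm x0 ^+ 2 <= M.
  by rewrite enorm_sqr; have := s1M; move: x0s1; rewrite /s /quad; lra.
have := supersolution_ineq C0 (ltW C10) (ltW M0) m0 e0 eE r0 rM (ltW p0) dW0 (f_pos _)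
  (WC _ (ltW cs)) dWp.
(* The contradiction: f(psi) <= f(u) at x0 by monotonicity, and [Sk] of the matrix of u, at least
   f(u)^(k+1), is bounded by the left side of the strict inequality. *)
apply/negP; rewrite -leNgt.
apply: (@le_trans _ _ (f (u x0) ^+ k.+1)).
  by rewrite lerXn2r ?nnegrE ?(ltW (f_pos _))// f_mono// ltW// -subr_gt0.
have Gk : 0 < Sk k.+1 (hess_mu mu u x0) by apply: uG; rewrite /= leqnn.
apply: (le_trans (powR_inv_le _ (ltW (f_pos _)) (ltW Gk) (usub x0))) => //.
rewrite enorm_sqr; apply: Sk_rank1_le.
- rewrite /hess_mu linearD/= tr_scalar_mx; congr (_ + _).
  by apply/matrixP => i j; rewrite !mxE; exact: schwarz.
- by rewrite mulr_ge0// addr_ge0// mulr_ge0.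
- by apply: mulr_ge0; [rewrite exprn_ge0// ltW|exact: mulr_ge0 dW0 (ltW p0)].
- move=> w; have [_ Hw] := T w.
  rewrite /hess_mu gE enorm_scale// mulmxDr mulmxDl mul_mx_scalar -scalemxAl !entryE.
  have ww := dot_ge0 w.
  have mur : mu * (A * p s * enorm x0) * (w *m w^T) 0 0 <=
      m * (A * p s * enorm x0) * (w *m w^T) 0 0.
    exact: (ler_wpM2r ww (ler_wpM2r (mulr_ge0 Ap0 r0) (ler_norm mu))).
  have sym : (w *m x0^T) 0 0 = (x0 *m w^T) 0 0.
    by rewrite !mxE; apply: eq_bigr => i _; rewrite !mxE mulrC.
  rewrite sym; move: Hw mur; rewrite /q; set X := (w *m hess u x0 *m w^T) 0 0.
  rewrite -/A; lra.
- by apply: uG.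
Qed.

Unset Implicit Arguments.

Theorem theorem1p1 (R : realType) (n k : nat) (mu : R) (f : R -> R) (a : R)
    (hn : (1 <= n)%N) (hk : (1 <= k <= n)%N)
    (f_cont : continuous f) (f_pos : forall t : R, 0 < f t)
    (f_mono : forall s t : R, s <= t -> f s <= f t)
    (ha : 0 < a) :
  ((k = 1%N \/ ((2 <= k)%N /\ 0 <= mu)) ->
     KO_integral k f a = +oo%E ->
     exists u : 'rV[R]_n -> R, is_subsolution k mu f u) /\
  (mu < mu0 R n k ->
     (KO_integral k f a < +oo)%E ->
     ~ exists u : 'rV[R]_n -> R, is_subsolution k mu f u).
Proof.
case: n hn hk => [//|n] _; case: k => [//|k] hk; split.
  move=> kmu; apply: existence => //.
  by case: kmu => [[->]|[_ mu_ge0]]; [left|right].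
by move=> _; exact: nonexistence.
Qed.
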